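(* For all integers $d\ge 2$ and all fugacities $\lambda<2^{1-d}$ ($\lambda\ge0$), the single-center dynamics for the hard sphere model on $\mathbb{R}^d$ has optimal temporal mixing at fugacity $\lambda$.
   Context: Let $r=r_d>0$ be the radius for which a ball of radius $r$ in $\mathbb{R}^d$ has volume $1$; $B_\ell(x)$ is the open ball of radius $\ell$ about $x$, and $|A|$ is Lebesgue measure. For compact measurable $\Lambda\subset\mathbb{R}^d$ let $\Lambda_{\mathrm{Int}}=\{x\in\Lambda:\mathrm{dist}(x,\Lambda^c)\ge r\}$. A boundary condition is a (measurable) set $\tau\subseteq\Lambda_{\mathrm{Int}}$ of forbidden locations for centers. $\Omega_\Lambda^\tau$ is the set of all finite point sets in $\Lambda_{\mathrm{Int}}\setminus\tau$ whose points are at pairwise distance at least $2r$. Single-center dynamics: for $|\Lambda|>0$ this is the Markov chain on $\Omega_\Lambda^\tau$ which, given $X_t$, forms $X_{t+1}$ as follows. (1) Pick $x\in\Lambda$ uniformly at random. (2) With probability $1/(1+\lambda)$ set $X_{t+1}=X_t\setminus B_r(x)$. (3) With probability $\lambda/(1+\lambda)$, let $X'=X_t\cup\{x\}$; set $X_{t+1}=X'$ if $X'\in\Omega_\Lambda^\tau$, and $X_{t+1}=X_t$ otherwise. Optimal temporal mixing: the single-center dynamics on $\mathbb{R}^d$ has optimal temporal mixing at fugacity $\lambda$ if there exist $b,c>0$ such that for any compact measurable $\Lambda\subset\mathbb{R}^d$ (of positive volume), with $n=|\Lambda|$, any boundary condition $\tau$, any $s>0$, and any two instances $(X_t),(Y_t)$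 of the single-center dynamics on $\Omega_\Lambda^\tau$ (with arbitrary initial distributions), $$\|X_{\lfloor sn\rfloor}-Y_{\lfloor sn\rfloor}\|_{TV}\le b\,n\,e^{-cs},$$ where the left side is the total variation distance between the laws of $X_{\lfloor sn\rfloor}$ and $Y_{\lfloor sn\rfloor}$. *)

(* Defs.v *)
From HB Require Import structures.
From mathcomp Require Import all_boot all_order all_algebra finmap.
From mathcomp Require Import all_classical all_reals all_analysis.

Set Implicit Arguments.
Unset Strict Implicit.
Unset Printing Implicit Defensive.

Import Order.TTheory GRing.Theory Num.Theory.
Import numFieldNormedType.Exports.

Local Open Scope classical_set_scope.
Local Open Scope ring_scope.

(* R^d is 'rV[R]_d.  Its sigma-algebra is the product (= Borel) one, generated
   by the coordinates; its topology is the library's.  The library norm on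
   'rV[R]_d is the sup norm, so the Euclidean distance is introduced below. *)
Section measurable_row.
Context (R : realType) (n : nat).

Let coord (i : 'I_n) (x : 'rV[R]_n) : R := x ord0 i.

Let row_set0 : g_sigma_preimage coord set0.
Proof. exact: sigma_algebra0. Qed.

Let row_setC A : g_sigma_preimage coord A -> g_sigma_preimage coord (~` A).
Proof. exact: sigma_algebraC. Qed.

Let row_bigcup (F : (set 'rV[R]_n)^nat) :
  (forall i, g_sigma_preimage coord (F i)) ->
  g_sigma_preimage coord (\bigcup_i (F i)).
Proof. exact: sigma_algebra_bigcup. Qed.

HB.instance Definition _ := @isMeasurable.Build default_measure_display
  'rV[R]_n (g_sigma_preimage coord) row_set0 row_setC row_bigcup.

Lemma measurable_coord (i : 'I_n) :
  measurable_fun [set: 'rV[R]_n] (fun x : 'rV[R]_n => x ord0 i).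
Proof.
move=> _ Y mY; rewrite setTI; apply: sub_sigma_algebra => /=.
rewrite -bigcup_seq/=; exists i => /=; first by rewrite mem_index_enum.
by exists Y => //; rewrite setTI.
Qed.

Lemma measurable_rowP d (T : measurableType d) (f : T -> 'rV[R]_n) :
  (forall i, measurable_fun [set: T] (fun t => f t ord0 i)) ->
  measurable_fun [set: T] f.
Proof.
move=> mf; suff : g_sigma_preimage (fun i => coord i \o f) `<=` measurable.
  rewrite g_sigma_preimage_comp => prefS _ A mA.
  by apply: prefS; exists A.
apply: smallest_sub; first exact: sigma_algebra_measurable.
rewrite -bigcup_seq => A [i _] [B mB <-].
exact: mf.
Qed.

End measurable_row.

(* Lebesgue measure on R^d: the d-fold product of Lebesgue measure on R,
   transported to row vectors. *)
Section row_lebesgue.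
Local Open Scope ereal_scope.
Context (R : realType).

Definition row_cons n (p : R * 'rV[R]_n) : 'rV[R]_n.+1 :=
  \row_i (if unlift ord0 i is Some j then p.2 ord0 j else p.1).

Lemma measurable_row_cons n : measurable_fun [set: R * 'rV[R]_n] (@row_cons n).
Proof.
apply: measurable_rowP => i; under eq_fun do rewrite mxE.
case: unliftP => [j _|_]; last exact: measurable_fst.
exact: (measurableT_comp (measurable_coord j) measurable_snd).
Qed.

Definition row_uncons n (v : 'rV[R]_n.+1) : R * 'rV[R]_n :=
  (v ord0 ord0, \row_j v ord0 (lift ord0 j)).

Lemma measurable_row_uncons n :
  measurable_fun [set: 'rV[R]_n.+1] (@row_uncons n).
Proof.
apply: measurable_fun_pair => /=; first exact: measurable_coord.
apply: measurable_rowP => i; under eq_fun do rewrite mxE.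
exact: measurable_coord.
Qed.

Lemma row_consK n : cancel (@row_cons n) (@row_uncons n).
Proof.
case=> x v; congr pair; first by rewrite mxE unlift_none.
by apply/rowP => j; rewrite !mxE liftK.
Qed.

Section step.
Variables (n : nat) (m : {sigma_finite_measure set 'rV[R]_n -> \bar R}).

Definition row_lebesgue_step :=
  pushforward (@lebesgue_measure R \x m) (@row_cons n).

Let mcons A : measurable A -> measurable (@row_cons n @^-1` A).
Proof. by move=> mA; rewrite -[X in measurable X]setTI; exact: measurable_row_cons. Qed.

Let step0 : row_lebesgue_step set0 = 0.
Proof. by rewrite /row_lebesgue_step /pushforward preimage_set0 measure0. Qed.

Let step_ge0 A : 0 <= row_lebesgue_step A.
Proof. by rewrite /row_lebesgue_step /pushforward; exact: measure_ge0. Qed.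

Let step_sigma_additive : semi_sigma_additive row_lebesgue_step.
Proof.
move=> F mF tF mUF; rewrite /row_lebesgue_step /pushforward preimage_bigcup.
apply: measure_semi_sigma_additive.
- by move=> k; exact: mcons.
- apply/trivIsetP => /= i j _ _ ij; rewrite -preimage_setI.
  by move/trivIsetP : tF => /(_ _ _ _ _ ij) ->//; rewrite preimage_set0.
- by rewrite -preimage_bigcup; exact: mcons.
Qed.

HB.instance Definition _ := isMeasure.Build _ _ _ row_lebesgue_step
  step0 step_ge0 step_sigma_additive.

Let sigma_finite_step : sigma_finite setT row_lebesgue_step.
Proof.
have /sigma_finiteP[F [TF ndF Foo]] := sigma_finiteT (@lebesgue_measure R).
have /sigma_finiteP[G [TG ndG Goo]] := sigma_finiteT m.
exists (fun k => @row_uncons n @^-1` (F k `*` G k)) => [|k].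
  apply/seteqP; split => // v _.
  have [[i _ Fi] [j _ Gj]] : (\bigcup_k F k) (row_uncons v).1 /\
      (\bigcup_k G k) (row_uncons v).2 by rewrite -TF -TG.
  exists (maxn i j) => //; split.
  - by move: Fi; exact/subsetPset/ndF/leq_maxl.
  - by move: Gj; exact/subsetPset/ndG/leq_maxr.
have [mF Fk] := Foo k; have [mG Gk] := Goo k; split.
  rewrite -[X in measurable X]setTI; apply: measurable_row_uncons => //.
  exact: measurableX.
rewrite /row_lebesgue_step /pushforward -comp_preimage.
rewrite (_ : _ \o _ = id) ?preimage_id; last first.
  by apply/funext => p /=; rewrite row_consK.
by rewrite product_measure1E// lte_mul_pinfty// ge0_fin_numE.
Qed.

HB.instance Definition _ :=
  Measure_isSigmaFinite.Build _ _ _ row_lebesgue_step sigma_finite_step.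

End step.

Fixpoint row_lebesgue n : {sigma_finite_measure set 'rV[R]_n -> \bar R} :=
  if n is k.+1 then row_lebesgue_step (row_lebesgue k)
  else \d_ (0%R : 'rV[R]_0).

End row_lebesgue.

Lemma row_lebesgue_box (R : realType) n (a b : 'I_n -> R) :
  (forall i, a i <= b i) ->
  row_lebesgue R n [set v | forall i, v ord0 i \in `[a i, b i]] =
  (\prod_(i < n) (b i - a i))%:E.
Proof.
elim: n a b => [|n IH] a b ab.
  by rewrite big_ord0 /= diracE mem_set// => -[].
rewrite big_ord_recl /= /row_lebesgue_step /pushforward.
pose B := [set v : 'rV[R]_n |
  forall i, v ord0 i \in `[a (lift ord0 i), b (lift ord0 i)]].
have mB : measurable B.
  rewrite (_ : B = \bigcap_(i in [set: 'I_n]) ((fun v : 'rV[R]_n => v ord0 i) @^-1`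
      `[a (lift ord0 i), b (lift ord0 i)])); last first.
    by apply/seteqP; split => v /= Bv => [i _|i]; [exact: Bv|exact: (Bv i I)].
  apply: fin_bigcap_measurable => // i _.
  by rewrite -[X in measurable X]setTI; exact: measurable_coord.
rewrite (_ : _ @^-1` _ = `[a ord0, b ord0] `*` B); last first.
  apply/seteqP; split => -[x v] /=.
    move=> h; split; first by have := h ord0; rewrite mxE unlift_none.
    by move=> i; have := h (lift ord0 i); rewrite mxE liftK.
  move=> [xab vB] i; rewrite mxE; case: unliftP => [j ->|->]//; exact: vB.
rewrite product_measure1E// IH ?EFinM => [|i]; last exact: ab.
congr (_ * _)%E; rewrite [LHS](@lebesgue_measure_itv R `[a ord0, b ord0]).
by rewrite /= lte_fin; case: ltgtP (ab ord0) => // ->; rewrite subrr.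
Qed.

Section euclidean.
Context {R : realType} {d : nat}.

Definition eucl_dist (x y : 'rV[R]_d) : R :=
  Num.sqrt (\sum_(i < d) (x ord0 i - y ord0 i) ^+ 2).

Definition eucl_ball (l : R) (x : 'rV[R]_d) : set 'rV[R]_d :=
  [set y | eucl_dist x y < l].

(* Only used with A nonempty, where inf is the true infimum. *)
Definition dist_to (x : 'rV[R]_d) (A : set 'rV[R]_d) : R :=
  inf [set eucl_dist x y | y in A].

End euclidean.

Definition is_unit_volume_radius (R : realType) (d : nat) (r : R) : Prop :=
  0 < r /\ row_lebesgue R d (eucl_ball r 0) = 1%E.

(* Finite point configurations, with the sigma-algebra generated by the
   counting maps X |-> #(X `&` A), A Borel, as usual for point processes. *)
Section configurations.
Context (R : realType) (d : nat).

Definition count_in (A : set 'rV[R]_d) (X : {fset 'rV[R]_d}) : nat :=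
  #|` [fset y in X | y \in A]%fset |.

Definition counting_events : set (set {fset 'rV[R]_d}) :=
  [set E | exists2 A, measurable A & exists k, E = count_in A @^-1` [set k]].

Definition config : measurableType counting_events.-sigma :=
  g_sigma_algebraType counting_events.

End configurations.

Section markov_chain.
Context {dT dS : measure_display} {R : realType}.
Context {T : measurableType dT} {S : measurableType dS}.

(* X is a Markov chain with transition kernel K under P: given the history
   X_0, ..., X_t, the next state X_(t+1) has law K (X_t). *)
Definition is_markov_chain (P : probability T R) (K : S -> set S -> \bar R)
    (X : nat -> T -> S) : Prop :=
  (forall t, measurable_fun [set: T] (X t)) /\
  (forall (t : nat) (A : nat -> set S), (forall i, measurable (A i)) ->
    P (\bigcap_(i in `I_t.+2) X i @^-1` A i) =
    \int[P]_(w in \bigcap_(i in `I_t.+1) X i @^-1` A i)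
      K (X t w) (A t.+1))%E.

Definition tv_dist (mu nu : set S -> \bar R) : \bar R :=
  ereal_sup [set `|mu A - nu A|%E | A in measurable].

End markov_chain.

Section single_center_dynamics.
Context {R : realType} {d : nat}.
Variables (r lambda : R) (L tau : set 'rV[R]_d).

Definition inner_region : set 'rV[R]_d :=
  [set x | L x /\ r <= dist_to x (~` L)].

(* The state space Omega_L^tau. *)
Definition hs_configs : set (config R d) :=
  [set X : {fset 'rV[R]_d} |
    (forall x, x \in X -> (inner_region `\` tau) x) /\
    (forall x y, x \in X -> y \in X -> x != y -> 2 * r <= eucl_dist x y)].

Definition remove_ball (X : {fset 'rV[R]_d}) (x : 'rV[R]_d) : config R d :=
  [fset y in X | y \notin eucl_ball r x]%fset.

Definition try_insert (X : {fset 'rV[R]_d}) (x : 'rV[R]_d) : config R d :=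
  let X' : config R d := (x |` X)%fset in
  if X' \in hs_configs then X' else X.

(* Probability that a uniform point of L lands in S. *)
Definition unif_prob (S : set 'rV[R]_d) : R :=
  fine (row_lebesgue R d (L `&` S)) / fine (row_lebesgue R d L).

Definition scd_kernel (X : config R d) (A : set (config R d)) : \bar R :=
  ((1 + lambda)^-1 * unif_prob [set x | A (remove_ball X x)] +
   lambda / (1 + lambda) * unif_prob [set x | A (try_insert X x)])%:E.

Definition is_single_center_dynamics (dT : measure_display)
    (T : measurableType dT) (P : probability T R)
    (X : nat -> T -> config R d) : Prop :=
  (forall t w, hs_configs (X t w)) /\ is_markov_chain P scd_kernel X.

End single_center_dynamics.

Definition optimal_temporal_mixing (R : realType) (d : nat) (r lambda : R)
    : Prop :=
  exists b c : R, 0 < b /\ 0 < c /\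
  forall L tau : set 'rV[R]_d,
    compact L -> measurable L -> (0 < row_lebesgue R d L)%E ->
    measurable tau -> tau `<=` inner_region r L ->
  forall s : R, 0 < s ->
  forall (d1 d2 : measure_display)
    (T1 : measurableType d1) (T2 : measurableType d2)
    (P1 : probability T1 R) (P2 : probability T2 R)
    (X : nat -> T1 -> config R d) (Y : nat -> T2 -> config R d),
    is_single_center_dynamics r lambda L tau P1 X ->
    is_single_center_dynamics r lambda L tau P2 Y ->
  let n := fine (row_lebesgue R d L) in
  let t := Num.truncn (s * n) in
  (tv_dist (pushforward P1 (X t)) (pushforward P2 (Y t))
     <= (b * n * expR (- (c * s)))%:E)%E.

(* Main.v *)
(* The distance between two configurations A and B is taken to be
     D(A, B) = #(A symdiff B) + (lambda / 2) vol(F(A) symdiff F(B)),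
   where F(A) is the set of admissible locations at distance at least 2r from
   all the points of A.  With n = vol(L) and m = #(A symdiff B), applying the
   same move to both configurations gives, up to the factor 1/((1 + lambda) n):
   - removals delete each disagreement at rate 1, and at each location y the
     rate at which "y separates F(A) from F(B)" is created by removals is at
     most k(y) - 2 [y separates], k(y) being the number of disagreements within
     2r of y; these integrate to at most 2^d m - 2 vol(F(A) symdiff F(B));
   - insertions create disagreements at rate vol(F(A) symdiff F(B)), which the
     previous -2 compensates exactly since D has weight lambda / 2, and by the
     symmetry of |x - y| < 2r they do not increase vol(F(A) symdiff F(B)).
   Hence D contracts by a factor 1 - kappa/n as soon as lambda 2^d < 2.  By
   duality no coupling is needed: if f is 1-Lipschitz for D then f composed with
   t steps of the transition operator is (1 - kappa/n)^t-Lipschitz, indicators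
   are 1-Lipschitz because D >= 1 off the diagonal, and D <= 4n because a
   configuration has at most n points. *)

Require Import Defs.
From HB Require Import structures.
From mathcomp Require Import all_boot all_order all_algebra finmap.
From mathcomp Require Import all_classical all_reals all_analysis measurable_realfun.
From mathcomp Require Import ring lra.

Set Implicit Arguments.
Unset Strict Implicit.
Unset Printing Implicit Defensive.

Import Order.TTheory GRing.Theory Num.Theory.
Import numFieldNormedType.Exports.

Local Open Scope classical_set_scope.
Local Open Scope ring_scope.

(** * Euclidean distance and affine invariance of Lebesgue measure *)

Section euclidean_distance.
Context {R : realType} {d : nat}.
Implicit Types x y z : 'rV[R]_d.

Lemma eucl_distC x y : eucl_dist x y = eucl_dist y x.
Proof.
congr Num.sqrt; apply: eq_bigr => i _.
by rewrite -[_ - _]opprB sqrrN.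
Qed.

(** Cauchy-Schwarz through Lagrange's identity: the double sum of [(f i * g j - f j * g i) ^+ 2] is
    twice the difference of the two sides. *)
Lemma sum_mul_sqr_le (I : finType) (f g : I -> R) :
  (\sum_i f i * g i) ^+ 2 <= (\sum_i f i ^+ 2) * (\sum_i g i ^+ 2).
Proof.
suff : 0 <= \sum_i \sum_j (f i * g j - f j * g i) ^+ 2.
  have -> : \sum_i \sum_j (f i * g j - f j * g i) ^+ 2 =
     ((\sum_i f i ^+ 2) * (\sum_i g i ^+ 2)
     - (\sum_i f i * g i) ^+ 2) *+ 2.
    transitivity (\sum_i \sum_j (f i ^+ 2 * g j ^+ 2 +
        (g i ^+ 2 * f j ^+ 2 - (f i * g i) * (f j * g j) *+ 2))).
      by apply: eq_bigr => i _; apply: eq_bigr => j _; ring.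
    under eq_bigr do rewrite big_split/= sumrB sumrMnl -!mulr_sumr.
    rewrite big_split/= sumrB sumrMnl -!mulr_suml.
    ring.
  by rewrite pmulrn_lge0// subr_ge0.
by apply: sumr_ge0 => i _; apply: sumr_ge0 => j _; exact: sqr_ge0.
Qed.

Lemma eucl_dist_triangle y x z :
  eucl_dist x z <= eucl_dist x y + eucl_dist y z.
Proof.
have S0 (u : 'I_d -> R) : 0 <= \sum_i u i ^+ 2.
  by apply: sumr_ge0 => i _; exact: sqr_ge0.
rewrite /eucl_dist; set a := fun i => x ord0 i - y ord0 i.
set b := fun i => y ord0 i - z ord0 i.
rewrite -[X in _ <= X]ger0_norm ?addr_ge0 ?sqrtr_ge0//.
rewrite -sqrtr_sqr ler_wsqrtr// sqrrD !sqr_sqrtr; try exact: S0.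
have -> : \sum_i (x ord0 i - z ord0 i) ^+ 2 =
    \sum_i a i ^+ 2 + (\sum_i a i * b i) *+ 2 + \sum_i b i ^+ 2.
  rewrite -sumrMnl -!big_split/=; apply: eq_bigr => i _.
  by rewrite /a /b; ring.
rewrite lerD2r lerD2l lerMn2r/=.
apply: le_trans (ler_norm _) _.
by rewrite -sqrtr_sqr -sqrtrM ?S0// ler_wsqrtr// sum_mul_sqr_le.
Qed.

Lemma eucl_distxx x : eucl_dist x x = 0.
Proof.
by rewrite /eucl_dist big1 ?sqrtr0// => i _; rewrite subrr expr0n.
Qed.

Lemma eucl_dist_scale (a : R) x y v : 0 <= a ->
  eucl_dist (a *: x + v) (a *: y + v) = a * eucl_dist x y.
Proof.
move=> a0; rewrite /eucl_dist.
under eq_bigr do rewrite !mxE opprD addrACA subrr addr0 -mulrBr exprMn.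
by rewrite -mulr_sumr sqrtrM ?sqr_ge0// sqrtr_sqr ger0_norm.
Qed.

Lemma measurable_eucl_dist :
  measurable_fun [set: 'rV[R]_d * 'rV[R]_d] (fun p => eucl_dist p.1 p.2).
Proof.
have msqrt : measurable_fun [set: R] (@Num.sqrt R).
  by apply: continuous_measurable_fun; exact: sqrt_continuous.
apply: (measurableT_comp msqrt); apply: measurable_sum => i.
apply: (@measurable_funX _ _ _ _
  (fun p : 'rV[R]_d * 'rV[R]_d => p.1 ord0 i - p.2 ord0 i)).
by apply: measurable_funB;
  [exact: (measurableT_comp (measurable_coord i) measurable_fst)|
   exact: (measurableT_comp (measurable_coord i) measurable_snd)].
Qed.

End euclidean_distance.

(** * Scaling and translation of Lebesgue measure *)

Section lebesgue_affine.
Local Open Scope ereal_scope.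
Context {R : realType}.

Lemma lebesgue_measure_affine (a b : R) (A : set (measurableTypeR R)) :
  (0 < a)%R -> measurable A ->
  a%:E * lebesgue_measure ((fun x : R => a * x + b)%R @^-1` A) =
  lebesgue_measure A.
Proof.
move=> a0 mA.
pose g : measurableTypeR R -> measurableTypeR R := (fun x : R => a * x + b)%R.
have mg : measurable_fun setT g.
  by apply: measurable_funD => //; exact: measurable_funM.
pose G : {mfun measurableTypeR R >-> measurableTypeR R} := HB.pack g (isMeasurableFun.Build _ _ _ _ g mg).
pose na := NngNum (ltW a0).
rewrite [RHS](@lebesgue_measure_unique R (mscale na (pushforward lebesgue_measure G)))//.
move=> _ [[l u]] _ <-/=; rewrite /mscale/= /pushforward/=.
rewrite (_ : g @^-1` _ = `](l - b) / a, (u - b) / a]%classic)%R; last first.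
  apply/seteqP; split => x /=; rewrite !in_itv/= /g => /andP[];
  by rewrite ltr_pdivrMr// ler_pdivlMr// mulrC => ? ?; lra.
rewrite !lebesgue_measure_itv/= !lte_fin ltr_pM2r ?invr_gt0// ltrD2r.
case: ifP => _; last by rewrite mule0.
by rewrite -!EFinB -EFinM; congr EFin; field; lra.
Qed.

Lemma measurable_row_affine n (a : R) (v : 'rV[R]_n) :
  measurable_fun [set: 'rV[R]_n] (fun x : 'rV[R]_n => a *: x + v)%R.
Proof.
apply: measurable_rowP => i; under eq_fun do rewrite !mxE.
apply: measurable_funD => //; apply: measurable_funM => //.
exact: measurable_coord.
Qed.

(** By induction on the dimension. The image of the product measure under the affine map, rescaled,
    agrees with the product measure on rectangles, and uniqueness of the product measure
    concludes. *)
Lemma row_lebesgue_affine n (a : R) (v : 'rV[R]_n) (A : set 'rV[R]_n) :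
  (0 < a)%R -> measurable A ->
  (a ^+ n)%:E * row_lebesgue R n ((fun x => a *: x + v)%R @^-1` A) =
  row_lebesgue R n A.
Proof.
move=> a0; elim: n v A => [|n IH] v A mA.
  rewrite expr0 mul1e (_ : (fun _ => _) = id) ?preimage_id//.
  by apply/funext => x; rewrite [LHS]thinmx0 [RHS]thinmx0.
rewrite [row_lebesgue R n.+1]/= /row_lebesgue_step /pushforward.
set m := row_lebesgue R n in IH *.
pose b := v ord0 ord0; pose w : 'rV[R]_n := \row_j v ord0 (lift ord0 j).
pose g : measurableTypeR R * 'rV[R]_n -> measurableTypeR R * 'rV[R]_n :=
  (fun p => (a * p.1 + b, a *: p.2 + w))%R.
have mg : measurable_fun setT g.
  apply: measurable_fun_pair => /=.
    by apply: measurable_funD => //; exact: measurable_funM.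
  exact: (measurableT_comp (measurable_row_affine a w) measurable_snd).
pose G : {mfun (measurableTypeR R * 'rV[R]_n)%type >->
    (measurableTypeR R * 'rV[R]_n)%type} :=
  HB.pack g (isMeasurableFun.Build _ _ _ _ g mg).
have an0 : (0 <= a ^+ n.+1)%R by rewrite exprn_ge0// ltW.
pose na := NngNum an0.
have mA' : measurable (@row_cons R n @^-1` A).
  by rewrite -[X in measurable X]setTI; exact: measurable_row_cons.
rewrite [RHS](@product_measure_unique _ _ _ _ R _ m
  (mscale na (pushforward (lebesgue_measure \x m) G)))//.
  rewrite /mscale/= /pushforward; congr (_ * (_ \x _) _).
  have E p : row_cons (g p) = (a *: row_cons p + v)%R.
    by apply/rowP => i; rewrite !mxE; case: unliftP => [j|] -> /=; rewrite ?mxE.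
  by apply/seteqP; split => p /=; rewrite -E.
move=> X Y mX mY.
transitivity ((a ^+ n.+1)%:E * (lebesgue_measure \x m) (g @^-1` (X `*` Y))) => //.
rewrite (_ : g @^-1` _ = ((fun x => a * x + b)%R @^-1` X) `*`
   ((fun y => a *: y + w)%R @^-1` Y)); last by apply/seteqP; split.
rewrite product_measure1E//.
- rewrite -(IH w Y mY) exprS EFinM -muleA [X in a%:E * X]muleCA [LHS]muleA.
  by congr (_ * _); exact: lebesgue_measure_affine.
- rewrite -[X in measurable X]setTI.
  by apply: measurable_funD => //; exact: measurable_funM.
- rewrite -[X in measurable X]setTI; exact: measurable_row_affine.
Qed.

End lebesgue_affine.

(** * Balls, compact sets and the inner region *)

Section balls.
Context {R : realType} {d : nat}.
Implicit Types (x y v : 'rV[R]_d) (L : set 'rV[R]_d).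

Lemma measurable_dist_from x :
  measurable_fun [set: 'rV[R]_d] (fun y => eucl_dist x y).
Proof.
exact: (measurableT_comp measurable_eucl_dist (measurable_pair1 x)).
Qed.

Lemma measurable_eucl_ball l x : measurable (eucl_ball l x).
Proof.
rewrite -[X in measurable X]setTI.
rewrite [X in _ `&` X](_ : _ = eucl_dist x @^-1` `]-oo, l[%classic).
  exact: measurable_dist_from.
by apply/seteqP; split => y; rewrite /= in_itv.
Qed.

Lemma row_lebesgue_eucl_ball (a l : R) v : 0 < a ->
  row_lebesgue R d (eucl_ball (a * l) v) =
  ((a ^+ d)%:E * row_lebesgue R d (eucl_ball l 0))%E.
Proof.
move=> a0.
rewrite -(row_lebesgue_affine v a0); last exact: measurable_eucl_ball.
congr (_ * row_lebesgue R d _)%E.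
have E x : eucl_dist v (a *: x + v) = a * eucl_dist 0 x.
  rewrite -(eucl_dist_scale _ _ v) ?ltW//; congr eucl_dist.
  by rewrite scaler0 add0r.
by apply/seteqP; split => x /=; rewrite /eucl_ball/= E ltr_pM2l.
Qed.

Lemma compact_row_lebesgue_fin L : compact L -> measurable L ->
  (row_lebesgue R d L < +oo)%E.
Proof.
move=> cL mL.
have bdd (i : 'I_d) : exists M : R, 0 <= M /\
    forall x, L x -> x ord0 i \in `[- M, M].
  have : compact ((fun x : 'rV[R]_d => x ord0 i) @` L).
    apply: continuous_compact => //; apply: continuous_subspaceT.
    exact: coord_continuous.
  move=> /compact_bounded[M [Mr /(_ (Num.max 0 M + 1))]].
  have M1 : M < Num.max 0 M + 1.
    by rewrite (le_lt_trans (y := Num.max 0 M)) ?le_max ?lexx ?orbT// ltrDl.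
  move=> /(_ M1) bM; exists (Num.max 0 M + 1).
  split; first by rewrite addr_ge0// le_max lexx.
  by move=> x Lx; rewrite in_itv/= -ler_norml; apply: bM; exists x.
have [M /all_and2[M0 LM]] := choice bdd.
have mB : measurable [set v : 'rV[R]_d |
    forall i, v ord0 i \in `[- M i, M i]].
  rewrite [X in measurable X](_ : _ = \bigcap_(i in [set: 'I_d])
      ((fun v : 'rV[R]_d => v ord0 i) @^-1` `[- M i, M i])); last first.
    by apply/seteqP; split => v /= Bv => [i _|i]; [exact: Bv|exact: (Bv i I)].
  apply: fin_bigcap_measurable => // i _.
  by rewrite -[X in measurable X]setTI; exact: measurable_coord.
apply: (@le_lt_trans _ _ (row_lebesgue R d [set v : 'rV[R]_d |
    forall i, v ord0 i \in `[- M i, M i]])).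
  by apply: le_measure; rewrite ?inE// => x Lx i; exact: LM.
by rewrite row_lebesgue_box ?ltry// => i; rewrite ge0_cp.
Qed.

(** Each coordinate is approximated within [e / d.+1], so the squared distance is at most d e^2 / (d
    + 1)^2, which is below e^2. *)
Lemma eucl_ball_rat_approx x (e : R) : 0 < e ->
  exists q : 'rV[rat]_d, eucl_dist x (map_mx ratr q) < e.
Proof.
move=> e0; pose u : R := e / d.+1%:R.
have u0 : 0 < u by rewrite divr_gt0.
have qP i : exists q : rat, ratr q \in `]x ord0 i, x ord0 i + u[.
  by apply: rat_in_itvoo; rewrite ltrDl.
have [q {}qP] := choice qP; exists (\row_i q i).
rewrite -(ger0_norm (ltW e0)) -sqrtr_sqr ltr_sqrt ?exprn_gt0//.
apply: (@le_lt_trans _ _ (\sum_(i < d) u ^+ 2)).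
  apply: ler_sum => i _; rewrite !mxE -[_ - _]opprB sqrrN.
  have := qP i; rewrite in_itv/= => /andP[q1 q2].
  by rewrite lerXn2r// ?nnegrE; lra.
rewrite sumr_const card_ord -mulr_natr /u expr_div_n mulrAC -mulrA.
rewrite gtr_pMr ?exprn_gt0// ltr_pdivrMr ?exprn_gt0// mul1r -natrX ltr_nat.
by rewrite expnS expn1 mulnS ltn_addr.
Qed.

(** The part of [L] closer than [r] to the complement is covered by countably many rational balls
    [F q], each consisting only of points closer than [r] to the complement. *)
Lemma measurable_inner_region (r : R) L : 0 < r -> measurable L ->
  measurable (inner_region r L).
Proof.
move=> r0 mL.
(* If [L] is the whole space, [dist_to] is the infimum of the empty set, which is 0 by convention,
   and the inner region is empty. *)
have [LT|/set0P[y0 Ly0]] := eqVneq (~` L) set0.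
  rewrite (_ : inner_region r L = set0)//; apply/seteqP; split => x //= -[_].
  by rewrite /dist_to LT image_set0 inf0 leNgt r0.
pose F (q : 'rV[rat]_d * rat) : set 'rV[R]_d :=
  if `[< exists2 y, (~` L) y & eucl_dist (map_mx ratr q.1) y < r - ratr q.2 >]
  then eucl_ball (ratr q.2) (map_mx ratr q.1) else set0.
rewrite (_ : inner_region r L = L `\` \bigcup_q F q).
  apply: measurableD => //; apply: countable_bigcupT_measurable => //.
  by move=> q; rewrite /F; case: ifPn => _ //; exact: measurable_eucl_ball.
apply/seteqP; split => x [Lx].
  move=> rx; split=> // -[[q e] _]; rewrite /F/=; case: asboolP => // -[y Ly qy].
  rewrite /eucl_ball/= => qx; suff : dist_to x (~` L) < r by rewrite ltNge rx.
  apply: (@le_lt_trans _ _ (eucl_dist x y)).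
    apply: ge_inf; last by exists y.
    by exists 0 => _ [z _ <-]; exact: sqrtr_ge0.
  apply: le_lt_trans (eucl_dist_triangle (map_mx ratr q) _ _) _.
  by rewrite eucl_distC; lra.
move=> nF; split => //; apply: lb_le_inf; first by exists (eucl_dist x y0); exists y0.
move=> _ [y Ly <-]; rewrite leNgt; apply/negP => xy; apply: nF.
(* With [e] below half of the slack, a rational centre within [e] of [x] is at distance less than
   [r - e] from [y]. *)
have [e] : exists e : rat, ratr e \in `]0, (r - eucl_dist x y) / 2[.
  by apply: rat_in_itvoo; rewrite divr_gt0// subr_gt0.
rewrite in_itv/= => /andP[e0 er].
have [q qx] := eucl_ball_rat_approx x e0.
exists (q, e) => //; rewrite /F/=; case: asboolP => [_|].
  by rewrite /eucl_ball/= eucl_distC.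
case; exists y => //; apply: le_lt_trans (eucl_dist_triangle x _ _) _.
by rewrite eucl_distC; lra.
Qed.

Lemma inner_region_ball (r : R) L x y :
  inner_region r L x -> eucl_ball r x y -> L y.
Proof.
move=> [Lx rx] xy; apply: contrapT => Ly.
move: xy; rewrite /eucl_ball/= ltNge => /negP; apply.
apply: le_trans rx _; apply: ge_inf; last by exists y.
by exists 0 => _ [z _ <-]; exact: sqrtr_ge0.
Qed.

End balls.

(** * Measurability of the moves of the dynamics *)

Section configuration_measurability.
Context {R : realType} {d : nat}.
Local Notation E := 'rV[R]_d.

Lemma count_inE (A : set E) (X : {fset E}) :
  count_in A X = (\sum_(y <- X) (y \in A))%N.
Proof.
rewrite /count_in card_fset_sum1 -big_fset_condE/= big_mkcond/=.
by apply: eq_bigr => y _; case: (y \in A).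
Qed.

Lemma count_in_dirac (A : set E) (X : {fset E}) :
  (count_in A X)%:R%:E = (\sum_(y <- X) \d_y A)%E :> \bar R.
Proof.
rewrite count_inE natr_sum -sumEFin; apply: eq_bigr => y _.
by rewrite diracE.
Qed.

Lemma measurable_count_in (A : set E) : measurable A ->
  measurable_fun [set: config R d]
    (fun X : config R d => (count_in A X)%:R%:E : \bar R).
Proof.
move=> mA _ Y mY; rewrite setTI.
rewrite [X in measurable X](_ : _ = \bigcup_(k in [set k : nat | Y k%:R%:E])
    [set X : config R d | count_in A X = k]).
  apply: bigcup_measurable => k _; apply: sub_sigma_algebra.
  by exists A => //; exists k.
apply/seteqP; split => X /=; first by exists (count_in A X).
by move=> [k Yk /= ->].
Qed.

(** Joint measurability when the counted set moves with the parameter. Dynkin induction on [C]: the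
    count factors on a rectangle, is subtracted from the total for a complement, and is a series for
    a disjoint union. *)
Lemma measurable_count_in_ysection dT (T : measurableType dT)
    (C : set (E * T)) : measurable C ->
  measurable_fun [set: (config R d * T)%type]
    (fun p : config R d * T =>
      (count_in (ysection C p.2) p.1)%:R%:E : \bar R).
Proof.
rewrite measurable_prod_measurableType; move: C.
apply: (dynkin_induction (measurable_prod_measurableType _ _)).
- move=> _ _ [A1 mA1 [B1 mB1 <-]] [A2 mA2 [B2 mB2 <-]].
  exists (A1 `&` A2); first exact: measurableI.
  by exists (B1 `&` B2); [exact: measurableI|rewrite setXI].
- rewrite [X in measurable_fun _ X](_ : _ = (fun p : config R d * T =>
      (count_in setT p.1)%:R%:E)); last first.
    by apply/funext => p; rewrite -setXTT in_ysectionX ?in_setT.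
  exact: (measurableT_comp (measurable_count_in measurableT) measurable_fst).
- move=> _ [A mA [B mB <-]].
  rewrite [X in measurable_fun _ X](_ : _ = (fun p : config R d * T =>
      (count_in A p.1)%:R%:E * (\1_B p.2)%:E)%E).
    apply: emeasurable_funM.
      exact: (measurableT_comp (measurable_count_in mA) measurable_fst).
    by apply/measurable_EFinP; exact: (measurableT_comp _ measurable_snd).
  apply/funext => -[X t] /=; rewrite -EFinM indicE !count_inE.
  rewrite !natr_sum mulr_suml; congr EFin; apply: eq_bigr => y _.
  rewrite -natrM mulnb; congr (_%:R); congr nat_of_bool.
  by rewrite mem_ysection in_setX.
- move=> S mS mcS.
  rewrite [X in measurable_fun _ X](_ : _ = (fun p : config R d * T =>
     (count_in setT p.1)%:R%:E - (count_in (ysection S p.2) p.1)%:R%:E)%E).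
    apply: emeasurable_funB => //.
    exact: (measurableT_comp (measurable_count_in measurableT) measurable_fst).
  apply/funext => -[X t] /=; rewrite !count_inE -EFinB !natr_sum -sumrB.
  congr EFin; apply: eq_bigr => y _.
  by rewrite in_setT !mem_ysection in_setC; case: (_ \in _); rewrite ?subrr ?subr0.
- move=> F mF tF mcF.
  rewrite [X in measurable_fun _ X](_ : _ = (fun p : config R d * T =>
     \sum_(0 <= k <oo | k \in xpredT)
        (count_in (ysection (F k) p.2) p.1)%:R%:E)%E).
    by apply: ge0_emeasurable_sum => // k p _ _; rewrite lee_fin.
  (* Written as a finite sum of Dirac masses, the count inherits countable additivity term by
     term. *)
  apply/funext => -[X t] /=; rewrite count_in_dirac.
  under [in RHS]eq_eseriesr do rewrite count_in_dirac.
  rewrite nneseries_sum//; apply: eq_bigr => y _.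
  rewrite ysection_bigcup measure_semi_bigcup//.
  + by move=> k; exact: measurable_ysection.
  + exact: trivIset_ysection.
  + by apply: bigcup_measurable => k _; exact: measurable_ysection.
Qed.

Lemma measurable_config_fun dT (T : measurableType dT) (f : T -> config R d) :
  (forall A, measurable A ->
    measurable_fun [set: T] (fun t => (count_in A (f t))%:R%:E : \bar R)) ->
  measurable_fun [set: T] f.
Proof.
move=> mf; apply: (@measurability _ _ T (config R d) setT f
  (@counting_events R d)) => //.
move=> _ [_ [A mA [k ->]] <-].
rewrite setTI [X in measurable X](_ : _ =
   (fun t => (count_in A (f t))%:R%:E : \bar R) @^-1` [set k%:R%:E]).
  by rewrite -[X in measurable X]setTI; apply: mf => //; exact: emeasurable_set1.
apply/seteqP; split => t /= => [->//|[/eqP]].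
by rewrite eqr_nat => /eqP.
Qed.

End configuration_measurability.

(** * Removal and insertion as measurable maps *)

Section configuration_moves.
Context {R : realType} {d : nat}.
Local Notation E := 'rV[R]_d.
Variables (r : R) (W : set E).
Hypotheses (r0 : 0 < r) (mW : measurable W).

Definition free (A : {fset E}) (y : E) : bool :=
  all (fun a => 2 * r <= eucl_dist a y) A.

(** Decides acceptance from the new location alone, which makes measurability accessible; it agrees
    with [try_insert] on admissible configurations by [try_insertE]. *)
Definition insert_point (A : {fset E}) (x : E) : config R d :=
  if (x \in W) && free A x then (x |` A)%fset else A.

Lemma measurable_pred_set dT (T : measurableType dT) (b : T -> bool) :
  measurable_fun [set: T] b -> measurable [set t | b t].
Proof. by move=> mb; rewrite -[X in measurable X]setTI; exact: mb. Qed.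

Lemma in_setb (T : Type) (b : T -> bool) t : (t \in [set t | b t]) = b t.
Proof. by apply/idP/idP; rewrite in_setE. Qed.

Lemma free_notin (A : {fset E}) x : free A x -> x \notin A.
Proof.
move=> /allP fx; apply/negP => xA; have := fx _ xA.
by rewrite eucl_distxx leNgt mulr_gt0.
Qed.

Lemma free_count_in (A : {fset E}) y :
  free A y = (count_in [set a | eucl_dist a y < 2 * r]%R A == 0%N).
Proof.
rewrite count_inE sum_nat_seq_eq0; apply: eq_all => a /=.
by rewrite eqb0 in_setb leNgt.
Qed.

Lemma measurable_mem_set (V : set E) : measurable V ->
  measurable_fun [set: E] (fun x => x \in V).
Proof.
move=> mV; apply: (measurable_fun_bool true).
rewrite setTI (_ : _ @^-1` _ = V)//.
by apply/seteqP; split => x /=; [move/set_mem|move/mem_set].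
Qed.

Lemma measurable_remove_ball :
  measurable_fun [set: (config R d * E)%type]
    (fun p : config R d * E => remove_ball r p.1 p.2).
Proof.
apply: measurable_config_fun => A mA.
(* The points that survive the removal at [x] and lie in [A] are those of the section of [C] at
   [x]. *)
pose C : set (E * E) := [set p | (p.1 \in A) && (r <= eucl_dist p.1 p.2)].
have mC : measurable C.
  apply: measurable_pred_set; apply: measurable_and.
    exact: (measurableT_comp (measurable_mem_set mA) measurable_fst).
  apply: measurable_fun_ler => //.
  exact: measurable_eucl_dist.
rewrite [X in measurable_fun _ X](_ : _ = fun p : config R d * E =>
  (count_in (ysection C p.2) p.1)%:R%:E); first exact: measurable_count_in_ysection.
apply/funext => -[X x] /=; congr (_%:R%:E); rewrite !count_inE.
rewrite /remove_ball -big_fset_condE/= big_mkcond/=; apply: eq_bigr => y _.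
rewrite mem_ysection !in_setb/= -leNgt eucl_distC.
by case: (r <= _); rewrite ?andbT ?andbF.
Qed.

Lemma measurable_free :
  measurable_fun [set: (config R d * E)%type]
    (fun p : config R d * E => free p.1 p.2).
Proof.
pose C : set (E * E) := [set p | eucl_dist p.1 p.2 < 2 * r].
have mC : measurable C.
  apply: measurable_pred_set; apply: measurable_fun_ltr => //.
  exact: measurable_eucl_dist.
apply: (measurable_fun_bool true); rewrite setTI.
rewrite [X in measurable X](_ : _ = (fun p : config R d * E =>
  (count_in (ysection C p.2) p.1)%:R%:E : \bar R) @^-1` [set 0%E]).
  rewrite -[X in measurable X]setTI.
  by apply: measurable_count_in_ysection => //; exact: emeasurable_set1.
have H x : ysection C x = [set a | eucl_dist a x < 2 * r].
  by apply/funext => y; rewrite /ysection/= in_setb.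
apply/seteqP; split => -[X x] /=; rewrite free_count_in H; first by move/eqP->.
by case=> /eqP; rewrite pnatr_eq0.
Qed.

Lemma measurable_insert_point :
  measurable_fun [set: (config R d * E)%type]
    (fun p : config R d * E => insert_point p.1 p.2).
Proof.
apply: measurable_config_fun => A mA.
have mcA : measurable_fun [set: (config R d * E)%type]
    (fun p : config R d * E => (count_in A p.1)%:R%:E : \bar R).
  exact: (measurableT_comp (measurable_count_in mA) measurable_fst).
rewrite [X in measurable_fun _ X](_ : _ = fun p : config R d * E =>
  if (p.2 \in W) && free p.1 p.2 then
    (\1_A p.2)%:E + (count_in A p.1)%:R%:E else (count_in A p.1)%:R%:E)%E.
  apply: measurable_fun_ifT => //.
    apply: measurable_and; last exact: measurable_free.
    exact: (measurableT_comp (measurable_mem_set mW) measurable_snd).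
  apply: emeasurable_funD => //; apply/measurable_EFinP.
  exact: (measurableT_comp (measurable_indic mA) measurable_snd).
apply/funext => -[X x] /=; rewrite /insert_point.
case: ifP => // /andP[_ fx]; rewrite !count_inE indicE.
by rewrite big_fsetU1 ?free_notin//= natrD EFinD.
Qed.

Lemma remove_ball_config (L tau : set E) A x :
  hs_configs r L tau A -> hs_configs r L tau (remove_ball r A x).
Proof.
move=> [AW Ad]; split => [y|y z]; rewrite /remove_ball !in_fset/=.
  by move=> /andP[+ _]; exact: AW.
by move=> /andP[yA _] /andP[zA _]; exact: Ad.
Qed.

Lemma insert_point_config (L tau : set E) A x :
  W = inner_region r L `\` tau ->
  hs_configs r L tau A -> hs_configs r L tau (insert_point A x).
Proof.
move=> WE [AW Ad]; rewrite /insert_point; case: ifP => // /andP[Wx /allP fx].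
split => [y|y z]; rewrite !in_fset1U.
  by move=> /orP[/eqP->|/AW//]; rewrite -WE -in_setE.
move=> /orP[/eqP->|yA] /orP[/eqP->|zA]; rewrite ?eqxx// => yz.
- by rewrite eucl_distC; exact: fx.
- exact: fx.
- exact: Ad.
Qed.

Lemma try_insertE (L tau : set E) A x :
  W = inner_region r L `\` tau -> hs_configs r L tau A ->
  try_insert r L tau A x = insert_point A x.
Proof.
move=> WE [AW Ad]; rewrite /try_insert /insert_point.
(* If [x] is already present, both moves leave [A] unchanged, whatever their tests answer. *)
have [xA|xA] := boolP (x \in A).
  have -> : (x |` A)%fset = A by apply/fsetUidPr; rewrite fsub1set.
  by rewrite !if_same.
congr (if _ then _ else _); apply/idP/idP; rewrite in_setE.
  move=> [xAW xAd]; apply/andP; split.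
    by rewrite WE in_setE; apply: xAW; rewrite fset1U1.
  apply/allP => a aA; apply: xAd; rewrite ?fset1U1 ?fset1Ur//.
  by apply: contraNneq xA => <-.
move=> xf; have := @insert_point_config L tau A x WE (conj AW Ad).
by rewrite /insert_point xf.
Qed.

End configuration_moves.

(** * Integrals of integer-valued functions *)

Section counting_integrals.
Context {dT : measure_display} {T : measurableType dT} {R : realType}.
Implicit Types (f g : T -> nat) (b : T -> bool).

Definition measurable_nat f :=
  measurable_fun [set: T] (fun x => (f x)%:R%:E : \bar R).

Lemma measurable_natD f g :
  measurable_nat f -> measurable_nat g -> measurable_nat (fun x => f x + g x)%N.
Proof.
move=> mf mg; rewrite /measurable_nat.
under eq_fun do rewrite natrD EFinD; exact: emeasurable_funD.
Qed.

Lemma measurable_nat_cst k : measurable_nat (fun=> k).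
Proof. exact: measurable_cst. Qed.

Lemma measurable_nat_sum (I : Type) (s : seq I) (F : I -> T -> nat) :
  (forall i, measurable_nat (F i)) ->
  measurable_nat (fun x => \sum_(i <- s) F i x)%N.
Proof.
move=> mF; rewrite /measurable_nat.
under eq_fun do rewrite natr_sum -sumEFin; exact: emeasurable_sum.
Qed.

Lemma measurable_nat_bool b :
  measurable_fun [set: T] b -> measurable_nat (fun x => b x).
Proof.
move=> mb; rewrite /measurable_nat [X in measurable_fun _ X](_ : _ =
    fun x => if b x then 1%E else 0%E); first exact: measurable_fun_ifT.
by apply/funext => x; case: (b x).
Qed.

Variable mu : {measure set T -> \bar R}.
Definition nat_integral f : \bar R := (\int[mu]_x (f x)%:R%:E)%E.

Lemma nat_integral_ge0 f : (0 <= nat_integral f)%E.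
Proof. by apply: integral_ge0 => x _; rewrite lee_fin. Qed.

Lemma le_nat_integral f g : measurable_nat f -> measurable_nat g ->
  (forall x, f x <= g x)%N -> (nat_integral f <= nat_integral g)%E.
Proof.
move=> mf mg fg; apply: ge0_le_integral => // x _.
by rewrite lee_fin ler_nat.
Qed.

Lemma nat_integralD f g : measurable_nat f -> measurable_nat g ->
  nat_integral (fun x => f x + g x)%N = (nat_integral f + nat_integral g)%E.
Proof.
move=> mf mg; rewrite -ge0_integralD//.
by apply: eq_integral => x _; rewrite natrD EFinD.
Qed.

Lemma nat_integral_cst k : nat_integral (fun=> k) = (k%:R%:E * mu setT)%E.
Proof. by rewrite /nat_integral integral_cst. Qed.

Lemma nat_integral_sum (I : Type) (s : seq I) (F : I -> T -> nat) :
  (forall i, measurable_nat (F i)) ->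
  nat_integral (fun x => \sum_(i <- s) F i x)%N =
  (\sum_(i <- s) nat_integral (F i))%E.
Proof.
move=> mF; rewrite -ge0_integral_sum//.
by apply: eq_integral => x _; rewrite natr_sum sumEFin.
Qed.

Lemma nat_integral_bool b : measurable_fun [set: T] b ->
  nat_integral (fun x => b x) = mu [set x | b x].
Proof.
move=> mb; rewrite -[in RHS](setIT [set x | b x]) -integral_indic//.
  by apply: eq_integral => x _; rewrite indicE in_setb.
exact: measurable_pred_set.
Qed.

End counting_integrals.

Arguments measurable_nat {dT T} R f.

(** * Drift of the distance under removals and insertions *)

Section symmetric_difference.
Context {R : realType} {d : nat}.
Local Notation E := 'rV[R]_d.
Variables (r : R) (W : set E).
Implicit Types (A B : {fset E}).

Definition symd A B : {fset E} := ((A `\` B) `|` (B `\` A))%fset.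

(** Indicator of F(A) symdiff F(B), where [W] is the set of admissible locations. *)
Definition sep A B y : bool := (y \in W) && (free r A y (+) free r B y).

Lemma in_symd A B v : (v \in symd A B) = (v \in A) (+) (v \in B).
Proof. by rewrite !inE; case: (v \in A); case: (v \in B). Qed.

Lemma symdC A B : symd A B = symd B A.
Proof. by apply/fsetP => v; rewrite !in_symd addbC. Qed.

Lemma sepC A B y : sep A B y = sep B A y.
Proof. by rewrite /sep addbC. Qed.

Lemma in_remove_ball A x v :
  (v \in (remove_ball r A x : {fset E})) = (v \in A) && (r <= eucl_dist v x).
Proof. by rewrite !inE/= in_setb -leNgt eucl_distC. Qed.

Lemma symd_remove_ball A B x :
  symd (remove_ball r A x) (remove_ball r B x) = remove_ball r (symd A B) x.
Proof.
apply/fsetP => v; rewrite in_symd !in_remove_ball in_symd.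
by case: (r <= _); rewrite ?andbT ?andbF.
Qed.

Lemma card_remove_ball A x :
  (#|` (remove_ball r A x : {fset E})| + \sum_(v <- A) (eucl_dist v x < r)%R =
   #|` A|)%N.
Proof.
rewrite !card_fset_sum1 -big_fset_condE/= big_mkcond/= -big_split/=.
by apply: eq_bigr => v _; rewrite in_setb eucl_distC; case: (_ < _).
Qed.

Lemma free_remove_ball A x y : free r A y -> free r (remove_ball r A x) y.
Proof.
move=> /allP fA; apply/allP => v; rewrite in_remove_ball => /andP[vA _].
exact: fA.
Qed.

Lemma blockedP A y : reflect (exists2 a, a \in A & eucl_dist a y < 2 * r)
  (~~ free r A y).
Proof.
rewrite -has_predC; apply: (iffP hasP) => -[a aA ay]; exists a => //.
  by rewrite ltNge.
by rewrite /= -ltNge.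
Qed.

(* A blocking point lost by one of two blocked configurations is lost because
   it lies in the removed ball. *)
Lemma sep_remove_ball_le A B x y a b : a \in A -> eucl_dist a y < 2 * r ->
  b \in B -> eucl_dist b y < 2 * r ->
  (sep (remove_ball r A x) (remove_ball r B x) y <=
    (eucl_dist a x < r)%R + (eucl_dist b x < r)%R)%N.
Proof.
move=> aA ay bB byy.
have key C c : c \in C -> eucl_dist c y < 2 * r ->
    free r (remove_ball r C x) y -> eucl_dist c x < r.
  move=> cC cy /allP/(_ c); rewrite in_remove_ball cC/= => h.
  rewrite ltNge; apply/negP => rc; have := h rc.
  by rewrite leNgt cy.
rewrite /sep; have [fA|] := boolP (free r (remove_ball r A x) y).
  by rewrite (key A a)//; case: (_ && _).
have [fB|] := boolP (free r (remove_ball r B x) y); last by rewrite andbF.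
by rewrite (key B b)//; case: (_ && _); rewrite addn1.
Qed.

Lemma sep_remove_ball_common A B x y c : c \in A -> c \in B ->
  eucl_dist c y < 2 * r ->
  (sep (remove_ball r A x) (remove_ball r B x) y <= (eucl_dist c x < r)%R)%N.
Proof.
move=> cA cB cy; have := sep_remove_ball_le x cA cy cB cy.
by case: (_ < _) => //; case: (sep _ _ _).
Qed.

(** Only [x] can become a new disagreement, and only when exactly one of the two insertions is
    accepted. *)
Lemma symd_insert_point A B x :
  (#|` symd (insert_point r W A x) (insert_point r W B x)| <=
   #|` symd A B| + sep A B x)%N.
Proof.
have card1 (C D : {fset E}) : (forall v, v \in C -> v != x -> v \in D) ->
    (#|` C| <= #|` D| + 1)%N.
  move=> CD; apply: (@leq_trans #|` (x |` D)%fset|).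
    apply/fsubset_leq_card/fsubsetP => v vC; rewrite in_fset1U.
    by have [//|vx/=] := eqVneq v x; exact: CD.
  by rewrite cardfsU1 addnC leq_add2l leq_b1.
rewrite /insert_point /sep; case: (x \in W); last by rewrite addn0.
case: (free r A x); case: (free r B x) => /=; rewrite ?addn0//.
- apply/fsubset_leq_card/fsubsetP => v; rewrite !in_symd !in_fset1U.
  by case: (v == x) => //=.
- by apply: card1 => v; rewrite !in_symd in_fset1U => + /negPf vx; rewrite vx.
- by apply: card1 => v; rewrite !in_symd in_fset1U => + /negPf vx; rewrite vx.
Qed.

Lemma free_insert_point A x y : free r (insert_point r W A x) y =
  (if (x \in W) && free r A x then
     (2 * r <= eucl_dist x y) && free r A y else free r A y).
Proof.
rewrite /insert_point; case: ifP => // _; apply/allP/andP.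
  move=> h; split; first by apply: h; rewrite fset1U1.
  by apply/allP => a aA; apply: h; rewrite fset1Ur.
by move=> [xy /allP fA] a; rewrite in_fset1U => /orP[/eqP->//|/fA].
Qed.

(** If [x] is accepted by both configurations, every separating [y] near [x] becomes blocked in
    both. If [x] is accepted by only one, a [y] near [x] that was free in both becomes separating.
    The two correction terms are exchanged by swapping [x] and [y], so they cancel once
    integrated. *)
Lemma sep_insert_point_le A B x y :
  let near := (eucl_dist x y < 2 * r)%R in
  let both z := [&& z \in W, free r A z & free r B z] in
  (sep (insert_point r W A x) (insert_point r W B x) y +
     [&& both x, sep A B y & near] <=
   sep A B y + [&& sep A B x, both y & near])%N.
Proof.
(* Only seven booleans are involved; all their values are checked. *)
rewrite /= /sep !free_insert_point ltNge; move: (x \in W) (y \in W) => [] [];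
by move: (free r A x) (free r B x) (free r A y) (free r B y) (2 * r <= _)
  => [] [] [] [] [].
Qed.

End symmetric_difference.

(** * Effect of a removal on a fixed location *)

Section removal_drift.
Context {R : realType} {d : nat}.
Local Notation E := 'rV[R]_d.
Variables (r : R) (W : set E) (U : {finite_measure set E -> \bar R}) (n : R).
Hypothesis mW : measurable W.
Hypothesis Utot : U [set: E] = n%:E.
Hypothesis Uball : forall v, W v -> U (eucl_ball r v) = 1%E.
Implicit Types (A B : {fset E}).

Lemma measurable_sep dT (T : measurableType dT) (f g : T -> config R d)
    (h : T -> E) :
  measurable_fun [set: T] f -> measurable_fun [set: T] g ->
  measurable_fun [set: T] h ->
  measurable_fun [set: T] (fun t => sep r W (f t) (g t) (h t)).
Proof.
move=> mf mg mh; have mfree (k : T -> config R d) : measurable_fun setT k ->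
    measurable_fun [set: T] (fun t => free r (k t) (h t)).
  move=> mk; exact: (measurableT_comp (@measurable_free R d r)
    (measurable_fun_pair mk mh)).
apply: measurable_and; first exact: (measurableT_comp (measurable_mem_set mW)).
rewrite [X in measurable_fun _ X](_ : _ = fun t =>
  if free r (f t) (h t) then ~~ free r (g t) (h t) else free r (g t) (h t)).
  by apply: measurable_fun_ifT; [exact: mfree|apply: measurable_neg|]; exact: mfree.
by apply/funext => t; case: (free r (f t) _).
Qed.

Lemma measurable_near v (l : R) :
  measurable_fun [set: E] (fun x => eucl_dist v x < l)%R.
Proof. by apply: measurable_fun_ltr => //; exact: measurable_dist_from. Qed.

Lemma nat_integral_near v (l : R) :
  nat_integral U (fun x => (eucl_dist v x < l)%R) = U (eucl_ball l v).
Proof. by rewrite nat_integral_bool//; exact: measurable_near. Qed.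

(** For [A := symd _ _] its cardinality is the k(y) of the overview. *)
Definition nearby A y : {fset E} := [fset v in A | (eucl_dist v y < 2 * r)%R]%fset.

Lemma measurable_sep_remove A B y :
  measurable_nat R (fun x => sep r W (remove_ball r A x) (remove_ball r B x) y).
Proof.
have mrem C : measurable_fun [set: E] (fun x => remove_ball r C x).
  exact: (measurableT_comp (@measurable_remove_ball R d r)
    (measurable_pair1 (C : config R d))).
by apply: measurable_nat_bool; apply: measurable_sep.
Qed.

(** Say [y] is free for [A]; then every point of [B] blocking [y] is a disagreement. If there are
    two nearby disagreements, the trivial bound [n] suffices. If there is only one, [b], removals
    centred within [r] of [b] free [y] in both configurations, and these centres have mass 1. *)
Lemma removal_drift_sep A B y :
    {in A, forall v, W v} -> {in B, forall v, W v} -> sep r W A B y ->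
  (nat_integral U (fun x => sep r W (remove_ball r A x) (remove_ball r B x) y)
     + 2%:E <= n%:E + #|` nearby (symd A B) y|%:R%:E)%E.
Proof.
wlog fA : A B / free r A y => [H AW BW sAB|].
  have [fA|nfA] := boolP (free r A y); first exact: H.
  rewrite symdC; under eq_fun do rewrite sepC.
  apply: H => //; last by rewrite sepC.
  by move: sAB => /andP[_]; rewrite (negPf nfA).
move=> AW BW /andP[_]; rewrite fA/= => /blockedP[b bB byy].
have symdB v : v \in B -> eucl_dist v y < 2 * r -> v \in nearby (symd A B) y.
  move=> vB vy; rewrite !inE/= vy vB /= !andbT.
  apply/negP => vA; move/allP: fA => /(_ v vA).
  by rewrite leNgt vy.
have [k2|k1] := leqP 2 #|` nearby (symd A B) y|.
  apply: leeD; last by rewrite lee_fin ler_nat.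
  rewrite -[leRHS]mul1e -Utot -[1%E]/(1%:R%:E) -nat_integral_cst.
  apply: le_nat_integral; [exact: measurable_sep_remove|exact: measurable_nat_cst|].
  by move=> x; case: (sep _ _ _ _ _).
have k1' : (1 <= #|` nearby (symd A B) y|)%N.
  by rewrite cardfs_gt0; apply/fset0Pn; exists b; exact: symdB.
have -> : (2%:E = 1 + 1 :> \bar R)%E by [].
(* One unit is paid by the disagreement [b], the other by the ball around [b], on which [y] stops
   separating. *)
rewrite addeA; apply: leeD; last by rewrite lee_fin ler1n.
rewrite -(Uball (BW _ bB)) -nat_integral_near -nat_integralD; last 2 first.
- exact: measurable_sep_remove.
- by apply: measurable_nat_bool; exact: measurable_near.
rewrite -[leRHS]mul1e -Utot -[1%E]/(1%:R%:E) -nat_integral_cst.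
apply: le_nat_integral; [|exact: measurable_nat_cst|].
  apply: measurable_natD; first exact: measurable_sep_remove.
  by apply: measurable_nat_bool; exact: measurable_near.
move=> x; have [bx|_] := boolP (eucl_dist b x < r)%R; last first.
  by rewrite addn0; case: (sep _ _ _ _ _).
rewrite /sep free_remove_ball//.
suff -> : free r (remove_ball r B x) y by rewrite andbF.
apply/allP => v; rewrite in_remove_ball => /andP[vB vx].
rewrite leNgt; apply/negP => vy; move: k1; rewrite ltnNge => /negP; apply.
(* A surviving blocker [v] differs from the removed [b], and would be a second nearby
   disagreement. *)
have -> : 2%N = #|` [fset v; b]%fset|.
  rewrite cardfs2; have [vb|//] := eqVneq v b.
  by move: vx; rewrite vb leNgt bx.
apply/fsubset_leq_card/fsubsetP => w; rewrite in_fset2.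
by move=> /orP[] /eqP ->; exact: symdB.
Qed.

(** A location free in both configurations stays so. One blocked in both, by [a] and [b], can become
    separating only if [a] or [b] is removed, at cost 2. With fewer than two nearby disagreements
    the configurations share a blocker [c], whose removal is then necessary, at cost 1; with none,
    they agree near [y] and keep agreeing. *)
Lemma removal_drift_not_sep A B y :
    {in A, forall v, W v} -> {in B, forall v, W v} -> ~~ sep r W A B y ->
  (nat_integral U (fun x => sep r W (remove_ball r A x) (remove_ball r B x) y)
     <= #|` nearby (symd A B) y|%:R%:E)%E.
Proof.
move=> AW BW nsep.
have int0 : (forall x, sep r W (remove_ball r A x) (remove_ball r B x) y = false) ->
  nat_integral U (fun x => sep r W (remove_ball r A x) (remove_ball r B x) y) = 0%E.
  by move=> u0; rewrite /nat_integral integral0_eq// => x _; rewrite u0.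
have [yW|yW] := boolP (y \in W); last first.
  by rewrite int0 ?lee_fin// => x; rewrite /sep (negPf yW).
have : ~~ (free r A y (+) free r B y) by move: nsep; rewrite /sep yW.
have [fA|nfA] := boolP (free r A y).
  rewrite negbK => fB; rewrite int0 ?lee_fin// => x.
  by rewrite /sep !free_remove_ball// andbF.
move=> /= nfB.
have /blockedP[a aA ay] := nfA; have /blockedP[b bB byy] := nfB.
have ball1 v : W v -> nat_integral U (fun x => (eucl_dist v x < r)%R) = 1%E.
  by move=> Wv; rewrite nat_integral_near Uball.
have mball v : measurable_nat R (fun x : E => (eucl_dist v x < r)%R).
  exact: (measurable_nat_bool (measurable_near v r)).
have [k2|k1] := leqP 2 #|` nearby (symd A B) y|.
  apply: (@le_trans _ _ 2%:E); last by rewrite lee_fin ler_nat.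
  have -> : (2%:E = 1 + 1 :> \bar R)%E by [].
  rewrite -{1}(ball1 _ (AW _ aA)) -(ball1 _ (BW _ bB)) -nat_integralD//.
  apply: le_nat_integral; [exact: measurable_sep_remove|exact: measurable_natD|].
  by move=> x; exact: sep_remove_ball_le.
have [c [cA cB cy]] : exists c, [/\ c \in A, c \in B & eucl_dist c y < 2 * r].
  have [bA|bA] := boolP (b \in A); first by exists b.
  have [aB|aB] := boolP (a \in B); first by exists a.
  exfalso; move: k1; rewrite ltnNge => /negP; apply.
  have -> : 2%N = #|` [fset a; b]%fset|.
    by rewrite cardfs2; have [ab|//] := eqVneq a b; move: bA; rewrite -ab aA.
  apply/fsubset_leq_card/fsubsetP => w; rewrite in_fset2.
  by move=> /orP[] /eqP ->; rewrite !inE/= ?(aA, bB, aB, bA, ay, byy) ?orbT.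
have [k0|k0] := posnP #|` nearby (symd A B) y|.
  rewrite int0 ?lee_fin// => x; rewrite /sep yW/=.
  have agree C D : (forall v, v \in C -> eucl_dist v y < 2 * r -> v \in D) ->
      free r (remove_ball r D x) y -> free r (remove_ball r C x) y.
    move=> CD /allP fD; apply/allP => v; rewrite in_remove_ball => /andP[vC vx].
    rewrite leNgt; apply/negP => vy; have := fD v.
    by rewrite in_remove_ball vx CD// leNgt vy => /(_ erefl).
  have close0 v : eucl_dist v y < 2 * r -> (v \in A) = (v \in B).
    move=> vy; have := cardfs0_eq k0 => /fsetP/(_ v).
    rewrite in_fset0 !inE/= vy andbT.
    by case: (v \in A); case: (v \in B).
  suff -> : free r (remove_ball r A x) y = free r (remove_ball r B x) y.
    by rewrite addbb.
  by apply/idP/idP; apply: agree => v vC vy; rewrite ?close0// -close0.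
apply: (@le_trans _ _ 1%E); last by rewrite lee_fin ler1n.
rewrite -(ball1 _ (AW _ cA)).
apply: le_nat_integral => //; first exact: measurable_sep_remove.
by move=> x; exact: sep_remove_ball_common.
Qed.

Lemma removal_drift A B y :
    {in A, forall v, W v} -> {in B, forall v, W v} ->
  (nat_integral U (fun x => sep r W (remove_ball r A x) (remove_ball r B x) y)
     + (2 * sep r W A B y)%:R%:E <=
   n%:E * (sep r W A B y)%:R%:E + #|` nearby (symd A B) y|%:R%:E)%E.
Proof.
move=> AW BW; have [sAB|sAB] := boolP (sep r W A B y).
  by rewrite mule1; exact: removal_drift_sep.
by rewrite mule0 add0e adde0; exact: removal_drift_not_sep.
Qed.

End removal_drift.

(** * Double integrals of integer-valued functions *)

Section iterated_counting_integrals.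
Context {dT : measure_display} {T : measurableType dT} {R : realType}.
Variable U : {finite_measure set T -> \bar R}.
Implicit Types f g : T -> T -> nat.

Definition measurable_nat2 f := measurable_nat R (fun p : T * T => f p.1 p.2).

Definition iter_integral f : \bar R := (\int[U]_x nat_integral U (f x))%E.

Lemma measurable_nat2_fst f x : measurable_nat2 f -> measurable_nat R (f x).
Proof. by move=> mf; exact: (measurableT_comp mf (measurable_pair1 x)). Qed.

Lemma measurable_nat_integral f : measurable_nat2 f ->
  measurable_fun [set: T] (fun x => nat_integral U (f x)).
Proof.
by move=> mf; exact: (measurable_fun_fubini_tonelli_F
  (fun p : T * T => (f p.1 p.2)%:R%:E) mf).
Qed.

Lemma measurable_nat2_swap f : measurable_nat2 f -> measurable_nat2 (fun x y => f y x).
Proof.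
move=> mf; exact: (measurableT_comp (f := fun p : T * T => (f p.1 p.2)%:R%:E)
  mf (@measurable_swap _ _ T T)).
Qed.

Lemma iter_integral_swap f : measurable_nat2 f ->
  iter_integral f = iter_integral (fun x y => f y x).
Proof.
move=> mf; exact: (fubini_tonelli (fun p : T * T => (f p.1 p.2)%:R%:E) mf).
Qed.

Lemma iter_integralD f g : measurable_nat2 f -> measurable_nat2 g ->
  iter_integral (fun x y => f x y + g x y)%N =
  (iter_integral f + iter_integral g)%E.
Proof.
move=> mf mg; rewrite -ge0_integralD//;
  try by [move=> x _; exact: nat_integral_ge0|exact: measurable_nat_integral].
by apply: eq_integral => x _; rewrite nat_integralD//; exact: measurable_nat2_fst.
Qed.

Lemma le_iter_integral f g : measurable_nat2 f -> measurable_nat2 g ->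
  (forall x y, f x y <= g x y)%N -> (iter_integral f <= iter_integral g)%E.
Proof.
move=> mf mg fg; apply: ge0_le_integral => //;
  try by [move=> x _; exact: nat_integral_ge0|exact: measurable_nat_integral].
by move=> x _; apply: le_nat_integral => //; exact: measurable_nat2_fst.
Qed.

Lemma iter_integral_cst k :
  iter_integral (fun _ _ => k) = (k%:R%:E * U setT * U setT)%E.
Proof. by rewrite /iter_integral nat_integral_cst integral_cst. Qed.

Lemma iter_integral_const (f : T -> nat) :
  iter_integral (fun _ y => f y) = (U setT * nat_integral U f)%E.
Proof.
rewrite muleC -(@integral_cst _ _ _ U setT measurableT)//.
Qed.

End iterated_counting_integrals.

(** Combines a bound for removals with [lambda] times one for insertions. The nonnegativity
    hypotheses are what distributivity in [\bar R] asks for. *)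
Lemma lee_add_weighted (R : realType) (a1 a2 b1 b2 x1 x2 y : \bar R)
    (theta lambda : R) : 0 <= theta -> 0 <= lambda ->
  (0 <= b2 -> 0 <= x1 -> 0 <= x2 ->
   a1 <= b1 + theta%:E * x1 -> a2 <= b2 + theta%:E * x2 ->
   x1 + lambda%:E * x2 <= y ->
   a1 + lambda%:E * a2 <= b1 + lambda%:E * b2 + theta%:E * y)%E.
Proof.
move=> t0 l0 b20 x10 x20 h1 h2 h3.
have le : (0 <= lambda%:E)%E by rewrite lee_fin.
have te : (0 <= theta%:E)%E by rewrite lee_fin.
apply: (le_trans (leeD h1 (lee_wpmul2l le h2))).
rewrite ge0_muleDr ?mule_ge0// addeACA muleCA -ge0_muleDr ?mule_ge0//.
by apply: leeD => //; exact: lee_wpmul2l.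
Qed.

(** * Integrated drift of the two parts of the distance *)

Section drift.
Context {R : realType} {d : nat}.
Local Notation E := 'rV[R]_d.
Variables (r : R) (W : set E) (U : {finite_measure set E -> \bar R}) (n V : R).
Hypotheses (r0 : 0 < r) (mW : measurable W).
Hypothesis Utot : U [set: E] = n%:E.
Hypothesis Uball : forall v, W v -> U (eucl_ball r v) = 1%E.
Hypothesis Uball2 : forall v, W v -> (U (eucl_ball (2 * r) v) <= V%:E)%E.
Implicit Types (A B : {fset E}).

(** This is vol(F(A) symdiff F(B)) once [U] is Lebesgue measure restricted to [L]. *)
Definition gap A B : \bar R := nat_integral U (sep r W A B).

Let n0 : 0 <= n.
Proof. by rewrite -lee_fin -Utot. Qed.

Lemma measurable_nat2_sep (f g : E -> config R d) :
  measurable_fun [set: E] f -> measurable_fun [set: E] g ->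
  measurable_nat2 (R := R) (fun x y => sep r W (f x) (g x) y).
Proof.
move=> mf mg; apply: measurable_nat_bool; apply: measurable_sep => //.
- exact: (measurableT_comp mf measurable_fst).
- exact: (measurableT_comp mg measurable_fst).
Qed.

Lemma measurable_sep_cst A B : measurable_fun [set: E] (sep r W A B).
Proof. by apply: (@measurable_sep R d r W mW _ E (cst (A : config R d)) (cst (B : config R d)) id). Qed.

Lemma gap_ge0 A B : (0 <= gap A B)%E. Proof. exact: nat_integral_ge0. Qed.

Lemma gap_fin A B : gap A B \is a fin_num.
Proof.
rewrite ge0_fin_numE ?gap_ge0//; apply: (@le_lt_trans _ _ n%:E); last exact: ltry.
rewrite -[leRHS]mul1e -Utot -[1%E]/(1%:R%:E) -nat_integral_cst.
apply: le_nat_integral; last by move=> x; case: (sep _ _ _ _ _).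
  by apply: measurable_nat_bool; exact: measurable_sep_cst.
exact: measurable_nat_cst.
Qed.

Lemma measurable_remove A : measurable_fun [set: E] (fun x => remove_ball r A x).
Proof.
exact: (measurableT_comp (@measurable_remove_ball R d r)
  (measurable_pair1 (A : config R d))).
Qed.

Lemma measurable_insert A : measurable_fun [set: E] (fun x => insert_point r W A x).
Proof.
exact: (measurableT_comp (measurable_insert_point r0 mW)
  (measurable_pair1 (A : config R d))).
Qed.

Lemma card_remove_ballE A x :
  #|` (remove_ball r A x : {fset E})| = (\sum_(v <- A) (r <= eucl_dist v x)%R)%N.
Proof.
rewrite card_fset_sum1 -big_fset_condE/= big_mkcond/=.
by apply: eq_bigr => v _; rewrite in_setb -leNgt eucl_distC; case: (_ <= _).
Qed.

Lemma measurable_card_remove A :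
  measurable_nat R (fun x => #|` (remove_ball r A x : {fset E})|).
Proof.
rewrite /measurable_nat; under eq_fun do rewrite card_remove_ballE.
apply: measurable_nat_sum => v; apply: measurable_nat_bool.
by apply: measurable_fun_ler => //; exact: measurable_dist_from.
Qed.

(** Each point is deleted exactly when the centre falls in its [r]-ball, of mass 1. *)
Lemma removal_card_integral A : {in A, forall v, W v} ->
  (nat_integral U (fun x => #|` (remove_ball r A x : {fset E})|) + #|` A|%:R%:E =
   n%:E * #|` A|%:R%:E)%E.
Proof.
move=> AW; rewrite [RHS]muleC -Utot -nat_integral_cst.
have -> : nat_integral U (fun=> #|` A|) = nat_integral U (fun x =>
    #|` (remove_ball r A x : {fset E})| + \sum_(v <- A) (eucl_dist v x < r)%R)%N.
  by congr nat_integral; apply/funext => x; rewrite card_remove_ball.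
have mnear v : measurable_nat R (fun x : E => (eucl_dist v x < r)%R).
  exact: (measurable_nat_bool (measurable_near v r)).
rewrite nat_integralD//; [|exact: measurable_card_remove|exact: measurable_nat_sum].
congr (_ + _)%E; rewrite nat_integral_sum// card_fset_sum1 natr_sum -sumEFin.
rewrite big_seq [RHS]big_seq; apply: eq_bigr => v vA.
by rewrite nat_integral_near Uball//; exact: AW.
Qed.

Lemma measurable_close A : measurable_nat R (fun y => #|` nearby r A y|).
Proof.
rewrite /measurable_nat /nearby; under eq_fun do
  rewrite card_fset_sum1 -big_fset_condE/= big_mkcond/=.
apply: measurable_nat_sum => v.
under eq_fun do rewrite -[if _ then _ else _]/(nat_of_bool _).
exact: (measurable_nat_bool (measurable_near v (2 * r))).
Qed.

Lemma close_integral A : {in A, forall v, W v} ->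
  (nat_integral U (fun y => #|` nearby r A y|) <= V%:E * #|` A|%:R%:E)%E.
Proof.
move=> AW; rewrite [leLHS](_ : _ = nat_integral U (fun y =>
    \sum_(v <- A) (eucl_dist v y < 2 * r)%R)%N); last first.
  congr nat_integral; apply/funext => y.
  rewrite card_fset_sum1 -big_fset_condE/= big_mkcond/=.
  by apply: eq_bigr => v _; case: (_ < _).
rewrite nat_integral_sum; last first.
  by move=> v; exact: (measurable_nat_bool (measurable_near v (2 * r))).
rewrite card_fset_sum1 natr_sum -sumEFin ge0_sume_distrr//.
rewrite big_seq [leRHS]big_seq; apply: lee_sum => v vA.
by rewrite mule1 nat_integral_near; apply: Uball2; exact: AW.
Qed.

Lemma symd_sub A B : {in A, forall v, W v} -> {in B, forall v, W v} ->
  {in symd A B, forall v, W v}.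
Proof.
move=> AW BW v; rewrite in_symd.
by have [vA _|vA] := boolP (v \in A); [exact: AW|exact: BW].
Qed.

(** A point blocking [y] in one configuration cannot belong to the one where [y] is free, so it is a
    nearby disagreement. *)
Lemma sep_le_close A B y : (sep r W A B y <= #|` nearby r (symd A B) y|)%N.
Proof.
wlog fA : A B / free r A y => [H|].
  have [fA|nfA] := boolP (free r A y); first exact: H.
  have [fB|nfB] := boolP (free r B y); first by rewrite symdC sepC; exact: H.
  by rewrite /sep (negPf nfA) (negPf nfB) andbF.
rewrite /sep fA; have [|] := boolP (free r B y); first by rewrite andbF.
move=> /blockedP[b bB byy]; apply: leq_trans (leq_b1 _) _.
rewrite cardfs_gt0; apply/fset0Pn; exists b; rewrite !inE/= byy bB /= !andbT.
by apply/negP => /(allP fA); rewrite leNgt byy.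
Qed.

Lemma gap_le A B : {in A, forall v, W v} -> {in B, forall v, W v} ->
  (gap A B <= V%:E * #|` symd A B|%:R%:E)%E.
Proof.
move=> AW BW; apply: le_trans (close_integral (symd_sub AW BW)).
apply: le_nat_integral => [||y]; [|exact: measurable_close|exact: sep_le_close].
by apply: measurable_nat_bool; exact: measurable_sep_cst.
Qed.

(** Tonelli moves the integral over locations [y] outside; [removal_drift] applies for each [y], and
    [close_integral] bounds the integral of k(y). *)
Lemma removal_gap_integral A B :
    {in A, forall v, W v} -> {in B, forall v, W v} ->
  (\int[U]_x gap (remove_ball r A x) (remove_ball r B x) + 2%:E * gap A B <=
   n%:E * gap A B + V%:E * #|` symd A B|%:R%:E)%E.
Proof.
move=> AW BW.
have m2 := measurable_nat2_sep (measurable_remove A) (measurable_remove B).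
have msep : measurable_nat R (sep r W A B).
  by apply: measurable_nat_bool; exact: measurable_sep_cst.
have mclose := measurable_close (symd A B).
rewrite -[X in (X + _)%E]/(iter_integral U (fun x y => _)) iter_integral_swap//.
have -> : (2%:E * gap A B = nat_integral U (fun y => 2 * sep r W A B y)%N)%E.
  rewrite /gap /nat_integral -ge0_integralZl//.
  by apply: eq_integral => y _; rewrite natrM EFinM.
have mI := measurable_nat_integral U (measurable_nat2_swap m2).
rewrite -ge0_integralD//; last 2 first.
- by move=> y _; exact: nat_integral_ge0.
- rewrite /measurable_nat; under eq_fun do rewrite natrM EFinM.
  exact: measurable_funeM.
apply: (@le_trans _ _
    (\int[U]_y (n%:E * (sep r W A B y)%:R%:E + #|` nearby r (symd A B) y|%:R%:E))%E).
  apply: ge0_le_integral => //.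
  - by move=> y _; rewrite adde_ge0// nat_integral_ge0.
  - apply: emeasurable_funD => //; under eq_fun do rewrite natrM EFinM.
    exact: measurable_funeM.
  - by apply: emeasurable_funD => //; exact: measurable_funeM.
  - by move=> y _; exact: removal_drift.
rewrite ge0_integralD//; last 2 first.
- by move=> y _; rewrite mule_ge0// lee_fin.
- exact: measurable_funeM.
rewrite ge0_integralZl//; apply: leeD => //.
exact/close_integral/symd_sub.
Qed.

(** Integrates [sep_insert_point_le]. Its two correction terms are [P] and [P] with swapped
    arguments, which have the same double integral by Tonelli and the symmetry of the distance. *)
Lemma insertion_gap_integral A B :
  (\int[U]_x gap (insert_point r W A x) (insert_point r W B x) <=
   n%:E * gap A B)%E.
Proof.
have m2 := measurable_nat2_sep (measurable_insert A) (measurable_insert B).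
pose both z := [&& z \in W, free r A z & free r B z].
pose P x y := [&& both x, sep r W A B y & (eucl_dist x y < 2 * r)%R].
have mfree C : measurable_fun [set: E] (fun x => free r C x).
  exact: (measurableT_comp (@measurable_free R d r)
    (measurable_pair1 (C : config R d))).
have mboth : measurable_fun [set: E] both.
  apply: measurable_and; first exact: measurable_mem_set.
  by apply: measurable_and; exact: mfree.
have msep := measurable_sep_cst A B.
have mP : measurable_nat2 (R := R) P.
  apply: measurable_nat_bool; apply: measurable_and.
    exact: (measurableT_comp mboth measurable_fst).
  apply: measurable_and; first exact: (measurableT_comp msep measurable_snd).
  by apply: measurable_fun_ltr => //; exact: measurable_eucl_dist.
have mS : measurable_nat2 (R := R) (fun _ y => sep r W A B y).
  by apply: measurable_nat_bool; exact: (measurableT_comp msep measurable_snd).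
(* Finiteness permits adding the integral of [P] to both sides and cancelling it. *)
have Pfin : iter_integral U P \is a fin_num.
  rewrite ge0_fin_numE; last first.
    by apply: integral_ge0 => x _; exact: nat_integral_ge0.
  apply: (@le_lt_trans _ _ (iter_integral U (fun _ _ => 1%N))).
    apply: le_iter_integral => //; first exact: measurable_nat_cst.
    by move=> x y; case: (P x y).
  by rewrite iter_integral_cst Utot -!EFinM ltry.
rewrite -(leeD2rE _ _ Pfin) -[X in (X + _)%E]/(iter_integral U (fun x y => _)).
rewrite -iter_integralD// [in leRHS]iter_integral_swap//.
rewrite [X in (X + _)%E](_ : _ = iter_integral U (fun _ y => sep r W A B y)).
  have mPs := measurable_nat2_swap mP.
  rewrite -iter_integralD; [|exact: mS|exact: mPs].
  apply: le_iter_integral; [exact: measurable_natD|exact: measurable_natD|].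
  move=> x y; have := sep_insert_point_le r W A B x y.
  by rewrite /= [X in (_ <= _ + nat_of_bool X)%N -> _]andbCA /P /both (eucl_distC y x).
by rewrite iter_integral_const; congr (_ * _)%E; rewrite -Utot.
Qed.

Lemma insertion_card_integral A B :
  (\int[U]_x (#|` symd A B| + sep r W A B x)%:R%:E =
   n%:E * #|` symd A B|%:R%:E + gap A B)%E.
Proof.
rewrite -/(nat_integral U _) nat_integralD; last 2 first.
- exact: measurable_nat_cst.
- by apply: measurable_nat_bool; exact: measurable_sep_cst.
by rewrite nat_integral_cst muleC; congr (_ * _ + _)%E; rewrite -Utot.
Qed.

(** * Contraction of the weighted distance in one update *)

Variable lambda : R.
Hypotheses (lambda0 : 0 <= lambda) (lambdaV : lambda * V < 2).

Definition hs_metric A B : \bar R :=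
  (#|` symd A B|%:R%:E + (lambda / 2)%:E * gap A B)%E.

Lemma hs_metric_ge0 A B : (0 <= hs_metric A B)%E.
Proof.
by rewrite adde_ge0 ?lee_fin// mule_ge0 ?gap_ge0// lee_fin divr_ge0.
Qed.

Let rate := (1 + lambda) * n - (1 - lambda * V / 2) / 2.

(* An upper bound for the distance after an insertion attempt at [x] whose
   measurability in [x] is immediate. *)
Definition insertion_metric A B x : \bar R :=
  ((#|` symd A B| + sep r W A B x)%:R%:E +
   (lambda / 2)%:E * gap (insert_point r W A x) (insert_point r W B x))%E.

Lemma le_insertion_metric A B x :
  (hs_metric (insert_point r W A x) (insert_point r W B x) <=
   insertion_metric A B x)%E.
Proof. by apply: leeD => //; rewrite lee_fin ler_nat symd_insert_point. Qed.

Lemma measurable_symd_sep A B :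
  measurable_nat R (fun x : E => #|` symd A B| + sep r W A B x)%N.
Proof.
apply: measurable_natD; first exact: measurable_nat_cst.
by apply: measurable_nat_bool; exact: measurable_sep_cst.
Qed.

Lemma measurable_gap_pair (f g : E -> config R d) :
  measurable_fun [set: E] f -> measurable_fun [set: E] g ->
  measurable_fun [set: E] (fun x => gap (f x) (g x)).
Proof.
by move=> mf mg; exact: (measurable_nat_integral U (measurable_nat2_sep mf mg)).
Qed.

Lemma measurable_removal_metric A B : measurable_fun [set: E]
  (fun x => hs_metric (remove_ball r A x) (remove_ball r B x)).
Proof.
rewrite /hs_metric; under eq_fun do rewrite symd_remove_ball.
apply: emeasurable_funD; first exact: measurable_card_remove.
by apply: measurable_funeM; apply: measurable_gap_pair; exact: measurable_remove.
Qed.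

Lemma measurable_insertion_metric A B :
  measurable_fun [set: E] (insertion_metric A B).
Proof.
apply: emeasurable_funD; first exact: measurable_symd_sep.
by apply: measurable_funeM; apply: measurable_gap_pair; exact: measurable_insert.
Qed.

Lemma insertion_metric_ge0 A B x : (0 <= insertion_metric A B x)%E.
Proof.
by rewrite adde_ge0 ?lee_fin// mule_ge0 ?gap_ge0// lee_fin divr_ge0.
Qed.

Let fin_bound (x : \bar R) (y : R) : (0 <= x -> x <= y%:E -> exists z, x = z%:E)%E.
Proof.
by move=> x0 xy; exists (fine x); rewrite fineK// ge0_fin_numE// (le_lt_trans xy)// ltry.
Qed.

(** Write m for the number of disagreements, g for the gap and c = lambda / 2. The lambda g created
    by insertions cancels the -2 c g from removals, which leaves (1 + lambda) n D - m (1 - c V). By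
    [gap_le], D = m + c g is at most 2 m, so the loss is at least D (1 - c V) / 2; this is the
    origin of the halving in [rate]. *)
Lemma hs_metric_contraction A B :
    {in A, forall v, W v} -> {in B, forall v, W v} ->
  (\int[U]_x hs_metric (remove_ball r A x) (remove_ball r B x) +
   lambda%:E * \int[U]_x insertion_metric A B x <= rate%:E * hs_metric A B)%E.
Proof.
move=> AW BW.
have c0 : 0 <= lambda / 2 by rewrite divr_ge0.
have mrem := measurable_gap_pair (measurable_remove A) (measurable_remove B).
have mins := measurable_gap_pair (measurable_insert A) (measurable_insert B).
rewrite /hs_metric; under eq_integral do rewrite symd_remove_ball.
rewrite ge0_integralD//; last 3 first.
- exact: measurable_card_remove.
- by move=> x _; rewrite mule_ge0 ?gap_ge0// lee_fin.
- exact: measurable_funeM.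
rewrite ge0_integralZl//; last by move=> x _; exact: gap_ge0.
rewrite [X in (_ + lambda%:E * X)%E]ge0_integralD//; last 3 first.
- exact: measurable_symd_sep.
- by move=> x _; rewrite mule_ge0 ?gap_ge0// lee_fin.
- exact: measurable_funeM.
rewrite [X in (_ + lambda%:E * (_ + X))%E]ge0_integralZl//;
  last by move=> x _; exact: gap_ge0.
have := removal_card_integral (symd_sub AW BW).
have := removal_gap_integral AW BW.
have := insertion_gap_integral A B.
have := gap_le AW BW; have := gap_ge0 A B; have := gap_fin A B.
rewrite insertion_card_integral /nat_integral.
set m : R := #|` symd A B|%:R.
set rg := (\int[U]_x gap (remove_ball r A x) (remove_ball r B x))%E.
set ig := (\int[U]_x gap (insert_point r W A x) (insert_point r W B x))%E.
have rg0 : (0 <= rg)%E by apply: integral_ge0 => x _; exact: gap_ge0.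
have ig0 : (0 <= ig)%E by apply: integral_ge0 => x _; exact: gap_ge0.
set rc := (\int[U]_x _)%E.
have rc0 : (0 <= rc)%E by apply: integral_ge0 => x _; rewrite lee_fin.
have m0 : 0 <= m by rewrite ler0n.
move=> /fineK <-; move: (fine _) => g; rewrite -!EFinM !lee_fin => g0 gm.
(* Every integral is shown finite and replaced by a real, so that the conclusion becomes real
   arithmetic. *)
move=> igle; have [i iE] := fin_bound ig0 igle; move: igle; rewrite iE lee_fin.
move=> igle rgle.
have : (rg <= (n * g + V * m)%:E)%E.
  by apply: le_trans rgle; rewrite leeDl// lee_fin mulr_ge0.
move=> /(fin_bound rg0)[a aE]; move: rgle; rewrite aE -!EFinD lee_fin => rgle.
move=> rcE; have : (rc <= (n * m)%:E)%E by rewrite -rcE leeDl// lee_fin.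
move=> /(fin_bound rc0)[b bE]; move: rcE; rewrite bE -EFinD => -[rcE].
rewrite -?EFinM -?EFinD -?EFinM -?EFinD -?EFinM -?EFinD lee_fin /rate.
set c := lambda / 2 in c0 *.
have lE : lambda = 2 * c by rewrite /c; field.
have cV : c * V <= 1 by move: lambdaV; rewrite lE; lra.
have h1 := ler_wpM2l c0 rgle.
have h2 := ler_wpM2l lambda0 (ler_wpM2l c0 igle).
have h3 := ler_wpM2l c0 gm.
have h4 : 0 <= m * (1 - c * V) by rewrite mulr_ge0// subr_ge0.
(* The slack (1 - c V) (m - c g) / 2 is half the sum of [h5] and [h6]. *)
have h5 : 0 <= (1 - c * V) * (V * m - g) * c by rewrite !mulr_ge0// subr_ge0.
have h6 : 0 <= (1 - c * V) * (1 - c * V) * m.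
  by rewrite !mulr_ge0// subr_ge0.
rewrite (_ : lambda * V / 2 = c * V); last by rewrite /c; field.
move: h1 h2; rewrite lE => h1 h2; lra.
Qed.

(** Transition operator before division by (1 + lambda) n: removals have weight 1, insertions weight
    [lambda]. *)
Definition update_integral (f : config R d -> \bar R) (A : config R d) : \bar R :=
  (\int[U]_x f (remove_ball r A x) +
   lambda%:E * \int[U]_x f (insert_point r W A x))%E.

Lemma update_integral_ge0 f A : (forall A, 0 <= f A)%E ->
  (0 <= update_integral f A)%E.
Proof.
move=> f0; apply: adde_ge0; first by apply: integral_ge0 => x _.
by rewrite mule_ge0 ?lee_fin//; apply: integral_ge0 => x _.
Qed.

Lemma measurable_update_integral f :
  measurable_fun [set: config R d] f -> (forall A, 0 <= f A)%E ->
  measurable_fun [set: config R d] (update_integral f).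
Proof.
move=> mf f0; apply: emeasurable_funD.
  apply: (measurable_fun_fubini_tonelli_F (m2 := U)
    (fun p : config R d * E => f (remove_ball r p.1 p.2))) => //.
  exact: (measurableT_comp mf (@measurable_remove_ball R d r)).
apply: measurable_funeM.
apply: (measurable_fun_fubini_tonelli_F (m2 := U)
  (fun p : config R d * E => f (insert_point r W p.1 p.2))) => //.
exact: (measurableT_comp mf (measurable_insert_point r0 mW)).
Qed.

Variable S : set (config R d).
Hypothesis SW : forall A, S A -> {in (A : {fset E}), forall v, W v}.
Hypothesis Sremove : forall A x, S A -> S (remove_ball r A x).
Hypothesis Sinsert : forall A x, S A -> S (insert_point r W A x).

(** The Lipschitz bound of [f] is integrated over the common centre [x] of a same move applied to
    [A] and [B]; [S] is stable under both moves, so the bound stays available. *)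
Lemma update_integral_lipschitz f (theta : R) :
  measurable_fun [set: config R d] f -> (forall A, 0 <= f A)%E -> 0 <= theta ->
  (forall A B, S A -> S B -> f A <= f B + theta%:E * hs_metric A B)%E ->
  forall A B, S A -> S B ->
  (update_integral f A <=
   update_integral f B + (theta * rate)%:E * hs_metric A B)%E.
Proof.
move=> mf f0 theta0 flip A B SA SB.
have mfrem C : measurable_fun [set: E] (fun x => f (remove_ball r C x)).
  exact: (measurableT_comp mf (measurable_remove C)).
have mfins C : measurable_fun [set: E] (fun x => f (insert_point r W C x)).
  exact: (measurableT_comp mf (measurable_insert C)).
have mrm := measurable_removal_metric A B.
have mim := measurable_insertion_metric A B.
have Hrem : (\int[U]_x f (remove_ball r A x) <= \int[U]_x f (remove_ball r B x) +
    theta%:E * \int[U]_x hs_metric (remove_ball r A x) (remove_ball r B x))%E.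
  rewrite -ge0_integralZl//; last by move=> x _; exact: hs_metric_ge0.
  rewrite -ge0_integralD//; last 2 first.
  - by move=> x _; rewrite mule_ge0 ?hs_metric_ge0// lee_fin.
  - exact: measurable_funeM.
  apply: ge0_le_integral => //.
  - by apply: emeasurable_funD => //; exact: measurable_funeM.
  - by move=> x _; apply: flip; exact: Sremove.
have Hins : (\int[U]_x f (insert_point r W A x) <=
    \int[U]_x f (insert_point r W B x) +
    theta%:E * \int[U]_x insertion_metric A B x)%E.
  rewrite -ge0_integralZl//; last by move=> x _; exact: insertion_metric_ge0.
  rewrite -ge0_integralD//; last 2 first.
  - by move=> x _; rewrite mule_ge0 ?insertion_metric_ge0// lee_fin.
  - exact: measurable_funeM.
  apply: ge0_le_integral => //.
  - by apply: emeasurable_funD => //; exact: measurable_funeM.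
  - move=> x _; apply: (le_trans (flip _ _ (Sinsert x SA) (Sinsert x SB))).
    by apply: leeD => //; apply: lee_wpmul2l; rewrite ?lee_fin// le_insertion_metric.
have Ifins : (0 <= \int[U]_x f (insert_point r W B x))%E.
  by apply: integral_ge0 => x _.
have Irem : (0 <= \int[U]_x hs_metric (remove_ball r A x) (remove_ball r B x))%E.
  by apply: integral_ge0 => x _; exact: hs_metric_ge0.
have Iins : (0 <= \int[U]_x insertion_metric A B x)%E.
  by apply: integral_ge0 => x _; exact: insertion_metric_ge0.
have := lee_add_weighted theta0 lambda0 Ifins Irem Iins Hrem Hins
  (hs_metric_contraction (SW SA) (SW SB)).
by rewrite muleA -EFinM.
Qed.

End drift.

(** * Transition operator of the dynamics *)

(* [pushforward mu f] as a measure, the measurability of [f] being part of the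
   data instead of a side condition. *)
Definition image_measure {d1 d2 : measure_display} {T1 : measurableType d1}
    {T2 : measurableType d2} {R : realType} (mu : {measure set T1 -> \bar R})
    (f : T1 -> T2) (mf : measurable_fun [set: T1] f) :
  {measure set T2 -> \bar R}.
Proof. by refine (pushforward mu f); exact: mf. Defined.

Lemma ge0_integral_image_measure {d1 d2 : measure_display}
    {T1 : measurableType d1} {T2 : measurableType d2} {R : realType}
    (mu : {measure set T1 -> \bar R}) (f : T1 -> T2)
    (mf : measurable_fun [set: T1] f) (g : T2 -> \bar R) :
  measurable_fun [set: T2] g -> (forall y, 0 <= g y)%E ->
  (\int[image_measure mu mf]_y g y = \int[mu]_x g (f x))%E.
Proof.
by move=> mg g0; rewrite ge0_integral_pushforward// preimage_setT.
Qed.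

Section markov_step.
Context {R : realType} {d : nat}.
Local Notation E := 'rV[R]_d.
Variables (r : R) (W : set E) (U : {finite_measure set E -> \bar R}).
Variables (lambda a : R).
Hypotheses (r0 : 0 < r) (mW : measurable W) (lambda0 : 0 <= lambda) (a0 : 0 <= a).

Definition transition (f : config R d -> \bar R) (A : config R d) : \bar R :=
  (a%:E * update_integral r W U lambda f A)%E.

Lemma transition_ge0 f A : (forall A, 0 <= f A)%E -> (0 <= transition f A)%E.
Proof.
by move=> f0; rewrite mule_ge0 ?lee_fin// update_integral_ge0.
Qed.

Lemma measurable_transition f :
  measurable_fun [set: config R d] f -> (forall A, 0 <= f A)%E ->
  measurable_fun [set: config R d] (transition f).
Proof. by move=> mf f0; apply: measurable_funeM; exact: measurable_update_integral. Qed.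

Section one_step.
Context {dT : measure_display} {T : measurableType dT} (P : probability T R).
Variables (Z : T -> config R d).
Hypotheses (mZ : measurable_fun [set: T] Z).

Let removal (p : T * E) : config R d := remove_ball r (Z p.1) p.2.
Let insertion (p : T * E) : config R d := insert_point r W (Z p.1) p.2.

Let mpair : measurable_fun [set: (T * E)%type] (fun p : T * E => (Z p.1, p.2)).
Proof.
apply: measurable_fun_pair; last exact: measurable_snd.
exact: (measurableT_comp mZ measurable_fst).
Qed.

Let mremoval : measurable_fun setT removal.
Proof. exact: (measurableT_comp (@measurable_remove_ball R d r) mpair). Qed.

Let minsertion : measurable_fun setT insertion.
Proof. exact: (measurableT_comp (measurable_insert_point r0 mW) mpair). Qed.

(** Law of the state after one step from [Z], as a weighted sum of images of [P \x U] under the two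
    moves. *)
Let next_law : {measure set (config R d) -> \bar R} :=
  mscale (NngNum a0) (measure_add (image_measure (P \x U)%E mremoval)
    (mscale (NngNum lambda0) (image_measure (P \x U)%E minsertion))).

Let next_lawE f : measurable_fun [set: config R d] f -> (forall A, 0 <= f A)%E ->
  (\int[next_law]_A f A = \int[P]_w transition f (Z w))%E.
Proof.
move=> mf f0; rewrite /next_law ge0_integral_mscale//=.
rewrite ge0_integral_measure_add//= ge0_integral_mscale//=.
rewrite !ge0_integral_image_measure//.
have mfr : measurable_fun setT (f \o removal) by exact: measurableT_comp.
have mfi : measurable_fun setT (f \o insertion) by exact: measurableT_comp.
rewrite !fubini_tonelli1//=.
have mr := measurable_fun_fubini_tonelli_F (m2 := U) _ mfr (fun p => f0 _).
have mi := measurable_fun_fubini_tonelli_F (m2 := U) _ mfi (fun p => f0 _).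
rewrite -ge0_integralZl//; last by move=> w _; exact: integral_ge0.
rewrite -ge0_integralD//; last 3 first.
- by move=> w _; exact: integral_ge0.
- by move=> w _; rewrite mule_ge0 ?lee_fin//; exact: integral_ge0.
- exact: measurable_funeM.
rewrite -ge0_integralZl//.
- by apply: emeasurable_funD => //; exact: measurable_funeM.
- move=> w _; apply: adde_ge0; first exact: integral_ge0.
  by rewrite mule_ge0 ?lee_fin//; exact: integral_ge0.
Qed.

(** The hypothesis on indicators says that the law of [Z'] and [next_law] agree on measurable sets;
    hence they integrate every nonnegative measurable function alike. *)
Lemma markov_step_integral (Z' : T -> config R d) f :
  measurable_fun [set: T] Z' ->
  (forall C, measurable C ->
    P (Z' @^-1` C) = \int[P]_w transition (fun A => (\1_C A)%:E) (Z w))%E ->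
  measurable_fun [set: config R d] f -> (forall A, 0 <= f A)%E ->
  (\int[P]_w f (Z' w) = \int[P]_w transition f (Z w))%E.
Proof.
move=> mZ' lawZ' mf f0; rewrite -next_lawE//.
rewrite -(ge0_integral_image_measure P mZ' mf f0).
apply: eq_measure_integral => C mC _; rewrite /= /pushforward [LHS]lawZ'//.
rewrite -next_lawE//; last exact/measurable_EFinP/measurable_indic.
by rewrite integral_indic// setIT.
Qed.

End one_step.

(** Duality: the last step of the chain is absorbed into [f], until only the initial state
    remains. *)
Lemma markov_iter_integral {dT : measure_display} {T : measurableType dT}
    (P : probability T R) (X : nat -> T -> config R d) f t :
  (forall t, measurable_fun [set: T] (X t)) ->
  (forall t C, measurable C -> P (X t.+1 @^-1` C) =
    \int[P]_w transition (fun A => (\1_C A)%:E) (X t w))%E ->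
  measurable_fun [set: config R d] f -> (forall A, 0 <= f A)%E ->
  (\int[P]_w f (X t w) = \int[P]_w iter t transition f (X 0%N w))%E.
Proof.
move=> mX lawX; elim: t f => [//|t IH] f mf f0.
rewrite (markov_step_integral (mX t) (mX t.+1) (lawX t) mf f0) iterSr.
apply: IH; first exact: measurable_transition.
by move=> A; exact: transition_ge0.
Qed.

End markov_step.

(** Compares expectations on unrelated probability spaces: the inequality is integrated in [w1] with
    [w2] fixed, then in [w2], each total mass being 1. *)
Lemma le_integral_pointwise {R : realType} {d1 d2 : measure_display}
    {T1 : measurableType d1} {T2 : measurableType d2}
    (P1 : probability T1 R) (P2 : probability T2 R)
    (f : T1 -> \bar R) (g : T2 -> \bar R) (delta : R) :
  measurable_fun [set: T1] f -> measurable_fun [set: T2] g ->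
  (forall w, 0 <= f w)%E -> (forall w, 0 <= g w)%E -> 0 <= delta ->
  (forall w1 w2, f w1 <= g w2 + delta%:E)%E ->
  (\int[P1]_w f w <= \int[P2]_w g w + delta%:E)%E.
Proof.
move=> mf mg f0 g0 delta0 fg.
have int1 w2 : (\int[P1]_w f w <= g w2 + delta%:E)%E.
  rewrite -[leRHS]mule1 -(probability_setT P1) -integral_cst//.
  by apply: ge0_le_integral => //= w _; exact: fg.
have delta1 : (\int[P2]_w (delta%:E) = delta%:E)%E.
  by rewrite -[RHS]mule1 -(probability_setT P2) -integral_cst.
rewrite -[in leRHS]delta1 -ge0_integralD//.
rewrite -[leLHS]mule1 -(probability_setT P2) -integral_cst//.
apply: ge0_le_integral => //.
- by move=> w _; exact: integral_ge0.
- exact: emeasurable_funD.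
Qed.

(** * Mixing estimate *)

Section main_estimates.
Context {R : realType} {d : nat}.
Local Notation E := 'rV[R]_d.
Variables (r lambda : R) (L tau : set E).
Hypotheses (r_unit : is_unit_volume_radius d r) (lambda0 : 0 <= lambda).
Hypotheses (lambda_lt : lambda * 2 ^+ d < 2).
Hypotheses (mL : measurable L) (Lfin : (row_lebesgue R d L < +oo)%E).
Hypotheses (mtau : measurable tau).

Let n : R := fine (row_lebesgue R d L).
Let W : set E := inner_region r L `\` tau.
Let U : {finite_measure set E -> \bar R} := mfrestr mL Lfin.
Let r0 : 0 < r. Proof. by case: r_unit. Qed.

Let mW : measurable W.
Proof. by apply: measurableD => //; exact: measurable_inner_region. Qed.

Let Lfin_num : row_lebesgue R d L \is a fin_num.
Proof. by rewrite ge0_fin_numE. Qed.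

Let UE (A : set E) : U A = row_lebesgue R d (A `&` L).
Proof. by []. Qed.

Let Utot : U [set: E] = n%:E.
Proof. by rewrite UE setTI fineK. Qed.

Let n0 : 0 <= n. Proof. by rewrite -lee_fin -Utot. Qed.

Lemma unit_ball_volume v : row_lebesgue R d (eucl_ball r v) = 1%E.
Proof.
case: r_unit => _ r1.
by rewrite -[r]mul1r row_lebesgue_eucl_ball// r1 expr1n mule1.
Qed.

Lemma double_ball_volume v :
  row_lebesgue R d (eucl_ball (2 * r) v) = (2 ^+ d)%:E.
Proof. by case: r_unit => _ r1; rewrite row_lebesgue_eucl_ball// r1 mule1. Qed.

Let Uball v : W v -> U (eucl_ball r v) = 1%E.
Proof.
move=> [Lv _]; rewrite UE (_ : _ `&` L = eucl_ball r v) ?unit_ball_volume//.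
by apply/setIidPl => y; exact: inner_region_ball.
Qed.

Let Uball2 v : W v -> (U (eucl_ball (2 * r) v) <= (2 ^+ d)%:E)%E.
Proof.
move=> _; rewrite UE -(double_ball_volume v); apply: le_measure; rewrite ?inE//.
- by apply: measurableI => //; exact: measurable_eucl_ball.
- exact: measurable_eucl_ball.
Qed.

Lemma hs_configs_sub A : hs_configs r L tau A ->
  {in (A : {fset E}), forall v, W v}.
Proof. by case. Qed.

(* The balls of radius [r] around the points of a configuration are disjoint,
   have volume 1 and lie in [L]. *)
Lemma card_hs_config (A : {fset E}) : hs_configs r L tau A -> #|` A|%:R <= n.
Proof.
move=> SA; have AW := hs_configs_sub SA; rewrite -lee_fin -Utot.
have -> : #|` A|%:R%:E = nat_integral U (fun x =>
    \sum_(v <- A) (eucl_dist v x < r)%R)%N.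
  rewrite nat_integral_sum; last first.
    by move=> v; exact: (measurable_nat_bool (measurable_near v r)).
  rewrite card_fset_sum1 natr_sum -sumEFin big_seq [RHS]big_seq.
  by apply: eq_bigr => v vA; rewrite nat_integral_near Uball//; exact: AW.
rewrite -[leRHS]mul1e -[1%E]/(1%:R%:E) -nat_integral_cst.
apply: le_nat_integral; last first.
- move=> x; have -> : (\sum_(v <- A) (eucl_dist v x < r)%R =
      #|` [fset v in A | (eucl_dist v x < r)%R]%fset|)%N.
    rewrite card_fset_sum1 -big_fset_condE/= [RHS]big_mkcond/=.
    by apply: eq_bigr => v _; case: (_ < _).
  have [->|[v]] := fset_0Vmem [fset v in A | (eucl_dist v x < r)%R]%fset.
    by rewrite cardfs0.
  rewrite !inE/= => /andP[vA vx].
  rewrite -[leqRHS](cardfs1 v); apply/fsubset_leq_card/fsubsetP => w.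
  rewrite !inE/= => /andP[wA wx]; apply: contraTT isT => wv /=.
  have := SA.2 _ _ wA vA wv; rewrite leNgt => /negP; case.
  apply: le_lt_trans (eucl_dist_triangle x _ _) _.
  by rewrite (eucl_distC x v) mulr2n mulrDl mul1r ltrD.
- exact: measurable_nat_cst.
- apply: measurable_nat_sum => v.
  exact: (measurable_nat_bool (measurable_near v r)).
Qed.

Let a : R := ((1 + lambda) * n)^-1.
Let next := transition r W U lambda a.

Lemma scd_kernelE A C : 0 < n -> hs_configs r L tau A -> measurable C ->
  scd_kernel r lambda L tau A C = next (fun B => (\1_C B)%:E) A.
Proof.
move=> n_gt0 SA mC.
have unifE (f : E -> config R d) : measurable_fun [set: E] f ->
  (\int[U]_x (\1_C (f x))%:E)%E = (fine (row_lebesgue R d (L `&` [set x | C (f x)])))%:E.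
  move=> mf; have mfC : measurable [set x | C (f x)].
    by rewrite -[X in measurable X]setTI; exact: mf.
  transitivity (\int[U]_x (\1_[set x | C (f x)] x)%:E)%E.
    by apply: eq_integral => x _; rewrite !indicE; congr (_%:R%:E); apply/idP/idP;
      rewrite !in_setE.
  rewrite integral_indic// setIT -[LHS]/(row_lebesgue R d (_ `&` L)) setIC.
  rewrite fineK// ge0_fin_numE//.
  apply: le_lt_trans Lfin; apply: le_measure; rewrite ?inE//; exact: measurableI.
rewrite /next /transition /update_integral.
rewrite !unifE; [|exact: measurable_insert|exact: measurable_remove].
rewrite /scd_kernel /unif_prob -/n -(EFinM lambda) -EFinD -(EFinM a).
congr EFin.
have -> : [set x | C (try_insert r L tau A x)] = [set x | C (insert_point r W A x)].
  by apply/seteqP; split => x /=; rewrite (@try_insertE _ _ _ W).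
have nn0 : n != 0 by rewrite gt_eqF.
have l0 : 1 + lambda != 0 by rewrite gt_eqF// ltr_wpDr.
by rewrite /a; field; rewrite l0 nn0.
Qed.

(** Chosen so that the contraction weight of one update, multiplied by [a], is exactly [rho]. *)
Let kappa : R := (1 - lambda * 2 ^+ d / 2) / 2 / (1 + lambda).
Let rho : R := 1 - kappa / n.
Let metric := hs_metric r W U lambda.

Let l1 : 0 < 1 + lambda. Proof. by rewrite ltr_wpDr. Qed.

Let kappa_gt0 : 0 < kappa.
Proof. by rewrite !divr_gt0// subr_gt0 ltr_pdivrMr// mul1r. Qed.

Let kappa_lt1 : kappa < 1.
Proof.
rewrite ltr_pdivrMr// mul1r.
have : 0 <= lambda * 2 ^+ d by rewrite mulr_ge0// exprn_ge0.
by move: lambda0; lra.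
Qed.

(** Measurability and nonnegativity are carried through the induction because each step needs them
    for the previous iterate. With [1 <= n], [kappa < 1] makes [rho] nonnegative. *)
Lemma transition_iter_lipschitz t f : 1 <= n ->
  measurable_fun [set: config R d] f -> (forall A, 0 <= f A)%E ->
  (forall A B, hs_configs r L tau A -> hs_configs r L tau B ->
     f A <= f B + metric A B)%E ->
  [/\ measurable_fun [set: config R d] (iter t next f),
      (forall A, 0 <= iter t next f A)%E &
      (forall A B, hs_configs r L tau A -> hs_configs r L tau B ->
         iter t next f A <= iter t next f B + (rho ^+ t)%:E * metric A B)%E].
Proof.
move=> n1 mf f0 flip; have n_gt0 : 0 < n by apply: lt_le_trans n1.
have a_ge0 : 0 <= a by rewrite invr_ge0 mulr_ge0// ltW.
have rho0 : 0 <= rho.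
  rewrite subr_ge0 ler_pdivrMr// mul1r; apply: le_trans n1; exact: ltW.
elim: t => [|t [mI I0 IH]].
  by split=> // A B SA SB; rewrite expr0 mul1e; exact: flip.
split.
- exact: measurable_transition.
- by move=> A; exact: transition_ge0.
- move=> A B SA SB; rewrite !iterS /next /transition.
  have rateE : (1 + lambda) * n - (1 - lambda * 2 ^+ d / 2) / 2 =
      rho * ((1 + lambda) * n).
    have nn0 : n != 0 by rewrite gt_eqF.
    have l0 : 1 + lambda != 0 by rewrite gt_eqF.
    by rewrite /rho /kappa; field; rewrite l0 nn0.
  have := update_integral_lipschitz r0 mW Utot Uball Uball2 lambda0 lambda_lt
    hs_configs_sub (@remove_ball_config R d r L tau)
    (fun A x => @insert_point_config R d r W L tau A x erefl)
    mI I0 (exprn_ge0 t rho0) IH SA SB.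
  have a_ge0' : (0 <= a%:E)%E by rewrite lee_fin.
  rewrite rateE => /(lee_wpmul2l a_ge0') H; apply: (le_trans H).
  rewrite ge0_muleDr; last 2 first.
  - exact: update_integral_ge0.
  - rewrite mule_ge0 ?hs_metric_ge0// lee_fin !mulr_ge0 ?exprn_ge0//.
    exact: ltW.
  apply: leeD => //; rewrite muleA -EFinM exprSr (_ : a * _ = rho ^+ t * rho)//.
  have cancel (x y z : R) : z != 0 -> z^-1 * (x * (y * z)) = x * y.
    by move=> z0; field.
  by apply: cancel; rewrite mulf_neq0// gt_eqF.
Qed.

(** Distinct configurations have at least one disagreement, so their distance is at least 1. *)
Lemma hs_metric_indic A B C : (((\1_C A)%:E : \bar R) <= (\1_C B)%:E + metric A B)%E.
Proof.
have [->|AB] := eqVneq A B; first by rewrite leeDl// hs_metric_ge0.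
apply: (@le_trans _ _ 1%E); first by rewrite lee_fin indicE; case: (_ \in _).
apply: (@le_trans _ _ (metric A B)).
  apply: (@le_trans _ _ #|` symd A B|%:R%:E); last first.
    by rewrite leeDl// mule_ge0 ?gap_ge0// lee_fin divr_ge0.
  rewrite lee_fin ler1n cardfs_gt0; apply: contraNneq AB => AB0.
  apply/eqP/fsetP => v; have := in_symd A B v; rewrite AB0 in_fset0.
  by case: (v \in A); case: (v \in B).
by rewrite leeDr// lee_fin indicE.
Qed.

(** Two configurations of at most [n] points have at most 2 n disagreements, and the gap term is at
    most their number since lambda 2^d / 2 <= 1. *)
Lemma hs_metric_le A B : hs_configs r L tau A -> hs_configs r L tau B ->
  (metric A B <= (4 * n)%:E)%E.
Proof.
move=> SA SB.
have m2n : #|` symd A B|%:R <= 2 * n.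
  apply: (@le_trans _ _ (#|` A| + #|` B|)%:R).
    rewrite ler_nat (@leq_trans #|` (A `|` B)%fset|)//.
      apply/fsubset_leq_card/fsubsetP => v; rewrite in_symd in_fsetU.
      by case: (v \in A); case: (v \in B).
    by rewrite cardfsU leq_subr.
  by rewrite natrD mulr2n mulrDl mul1r lerD// card_hs_config.
rewrite (_ : 4 * n = 2 * n + 1 * (2 * n)); last by ring.
rewrite EFinD; apply: leeD; first by rewrite lee_fin.
apply: (@le_trans _ _ ((lambda / 2)%:E * ((2 ^+ d)%:E * #|` symd A B|%:R%:E))%E).
  apply: lee_wpmul2l; first by rewrite lee_fin divr_ge0.
  exact: (gap_le mW Uball2 (hs_configs_sub SA) (hs_configs_sub SB)).
rewrite -!EFinM lee_fin mulrA; apply: ler_pM => //.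
  by rewrite mulr_ge0 ?exprn_ge0// divr_ge0.
by move: lambda_lt; lra.
Qed.

Lemma hs_config_empty A : n < 1 -> hs_configs r L tau A -> A = fset0.
Proof.
move=> n1 /card_hs_config An; apply: cardfs0_eq; apply/eqP.
by rewrite -leqn0 -ltnS -(ltr_nat R) (le_lt_trans An).
Qed.

(** For [n < 1] the empty configuration is the only state, so the error is 0; [rho] could be
    negative there. *)
Let delta (t : nat) : R := if n < 1 then 0 else rho ^+ t * (4 * n).

Lemma chain_transition {dT : measure_display} {T : measurableType dT}
    (P : probability T R) (X : nat -> T -> config R d) :
  0 < n -> is_single_center_dynamics r lambda L tau P X ->
  forall t C, measurable C -> (P (X t.+1 @^-1` C) =
    \int[P]_w next (fun A => (\1_C A)%:E) (X t w))%E.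
Proof.
move=> n_gt0 [XS [mX chainX]] t C mC.
(* With no constraint on the states up to time [t], the path formula reduces to the one-step law. *)
have := chainX t (fun i => if i == t.+1 then C else setT).
rewrite eqxx => H; transitivity
  (P (\bigcap_(i in `I_t.+2) X i @^-1` (if i == t.+1 then C else setT))).
  congr (P _); apply/seteqP; split => w /=.
    by move=> XC i _; case: eqP => [->|].
  by move=> /(_ t.+1 (ltnSn _)); rewrite eqxx.
rewrite H; last by move=> i; case: ifP.
rewrite (_ : \bigcap_(i in _) _ = setT); last first.
  apply/seteqP; split => // w _ i /= it; rewrite ifF//.
  by apply/negbTE; rewrite neq_ltn it.
by apply: eq_integral => w _; rewrite scd_kernelE.
Qed.

(** For [1 <= n] both probabilities become expectations of the same iterated function at the initial
    states, which differ by at most [rho ^+ t] times the diameter 4 n. *)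
Lemma one_sided_mixing {d1 d2 : measure_display}
    {T1 : measurableType d1} {T2 : measurableType d2}
    (P1 : probability T1 R) (P2 : probability T2 R)
    (X : nat -> T1 -> config R d) (Y : nat -> T2 -> config R d) t C :
  0 < n ->
  is_single_center_dynamics r lambda L tau P1 X ->
  is_single_center_dynamics r lambda L tau P2 Y -> measurable C ->
  (P1 (X t @^-1` C) <= P2 (Y t @^-1` C) + (delta t)%:E)%E.
Proof.
move=> n_gt0 dX dY mC.
have [XS [mX _]] := dX; have [YS [mY _]] := dY.
have a_ge0 : 0 <= a by rewrite invr_ge0 mulr_ge0// ltW.
pose f : config R d -> \bar R := fun A => (\1_C A)%:E.
have mf : measurable_fun [set: config R d] f.
  exact/measurable_EFinP/measurable_indic.
have f0 A : (0 <= f A)%E by rewrite lee_fin.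
have PE (d' : measure_display) (T : measurableType d') (P : probability T R)
    (Z : T -> config R d) : measurable_fun setT Z ->
    (P (Z @^-1` C) = \int[P]_w f (Z w))%E.
  move=> mZ; rewrite -(ge0_integral_image_measure P mZ mf f0).
  by rewrite integral_indic// setIT.
rewrite !PE//.
have delta0 : 0 <= delta t.
  rewrite /delta; case: ltP => // n1; rewrite mulr_ge0 ?mulr_ge0//.
  rewrite exprn_ge0// subr_ge0 ler_pdivrMr// mul1r; apply: le_trans n1; exact: ltW.
have [n1|n1] := ltP n 1.
  apply: le_integral_pointwise => //; try exact: measurableT_comp.
  by move=> w1 w2; rewrite (hs_config_empty n1 (XS _ _))
    (hs_config_empty n1 (YS _ _)) leeDl// lee_fin.
have [mI I0 IH] := transition_iter_lipschitz t n1 mf f0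
  (fun A B _ _ => hs_metric_indic A B C).
rewrite (markov_iter_integral r0 mW lambda0 a_ge0 t mX
  (chain_transition n_gt0 dX) mf f0).
rewrite (markov_iter_integral r0 mW lambda0 a_ge0 t mY
  (chain_transition n_gt0 dY) mf f0).
apply: le_integral_pointwise => //; try exact: measurableT_comp.
move=> w1 w2; apply: le_trans (IH _ _ (XS _ _) (YS _ _)) _.
apply: leeD => //; rewrite /delta ltNge n1/= EFinM; apply: lee_wpmul2l.
  rewrite lee_fin exprn_ge0// subr_ge0 ler_pdivrMr// mul1r.
  by apply: le_trans n1; exact: ltW.
exact: hs_metric_le.
Qed.

Lemma delta_le (s : R) : 0 < s -> 0 < n ->
  delta (Num.truncn (s * n)) <= 4 * expR kappa * n * expR (- (kappa * s)).
Proof.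
move=> s0 n_gt0; rewrite /delta; case: ltP => [_|n1].
  by rewrite !mulr_ge0 ?expR_ge0.
have rho0 : 0 <= rho.
  by rewrite subr_ge0 ler_pdivrMr// mul1r; apply: le_trans n1; exact: ltW.
set t := Num.truncn _.
(* Rounding down loses less than one step, which costs a factor of at most [expR kappa]. *)
have tP : s * n < t%:R + 1.
  by rewrite natr1; apply: truncnS_gt.
have rho_exp : rho <= expR (- (kappa / n)) by exact: expR_ge1Dx.
apply: (@le_trans _ _ (expR (- (kappa / n) * t%:R) * (4 * n))).
  apply: ler_wpM2r; first by rewrite mulr_ge0.
  by rewrite expRM_natr lerXn2r// ?nnegrE ?expR_ge0.
rewrite (_ : 4 * _ * _ * _ = expR (kappa - kappa * s) * (4 * n)); last first.
  by rewrite expRD; ring.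
apply: ler_wpM2r; first by rewrite mulr_ge0.
rewrite ler_expR.
have kn : kappa / n <= kappa by rewrite ler_pdivrMr// ler_peMr// ltW.
have : kappa / n * (s * n) <= kappa / n * (t%:R + 1).
  by apply: ler_wpM2l; [rewrite divr_ge0// ltW|exact: ltW].
rewrite (_ : kappa / n * (s * n) = kappa * s); last first.
  by field; rewrite gt_eqF.
by move: kn; lra.
Qed.

Lemma mixing_bound {d1 d2 : measure_display}
    {T1 : measurableType d1} {T2 : measurableType d2}
    (P1 : probability T1 R) (P2 : probability T2 R)
    (X : nat -> T1 -> config R d) (Y : nat -> T2 -> config R d) (s : R) :
  0 < n -> 0 < s ->
  is_single_center_dynamics r lambda L tau P1 X ->
  is_single_center_dynamics r lambda L tau P2 Y ->
  (tv_dist (pushforward P1 (X (Num.truncn (s * n))))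
     (pushforward P2 (Y (Num.truncn (s * n))))
    <= (4 * expR kappa * n * expR (- (kappa * s)))%:E)%E.
Proof.
move=> n_gt0 s0 dX dY; set t := Num.truncn _.
apply: ub_ereal_sup => _ [C mC <-].
apply: (@le_trans _ _ (delta t)%:E); last by rewrite lee_fin delta_le.
have := one_sided_mixing t n_gt0 dX dY mC.
have := one_sided_mixing t n_gt0 dY dX mC.
have mpre dT (T : measurableType dT) (Z : T -> config R d) :
    measurable_fun setT Z -> measurable (Z @^-1` C).
  by move=> mZ; rewrite -[X in measurable X]setTI; exact: mZ.
have [p pE] : exists p, P1 (X t @^-1` C) = p%:E.
  exists (fine (P1 (X t @^-1` C))); rewrite fineK//.
  by apply: fin_num_measure; apply: mpre; case: dX => _ [].
have [q qE] : exists q, P2 (Y t @^-1` C) = q%:E.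
  exists (fine (P2 (Y t @^-1` C))); rewrite fineK//.
  by apply: fin_num_measure; apply: mpre; case: dY => _ [].
rewrite /pushforward pE qE -!EFinD abse_EFin !lee_fin ler_norml.
by move=> qp pq; apply/andP; split; lra.
Qed.

End main_estimates.
Theorem theorem2p1 (R : realType) (d : nat) (r lambda : R)
  (d_ge2 : (2 <= d)%N) (r_unit : is_unit_volume_radius d r)
  (lambda_ge0 : 0 <= lambda) (lambda_lt : lambda < 2 ^ (1 - d%:Z)) :
  optimal_temporal_mixing d r lambda.
Proof.
have lambda_lt2 : lambda * 2 ^+ d < 2.
  move: lambda_lt; rewrite expfzDr// expr1z -(ltr_pM2r (exprn_gt0 d (ltr0n R 2))).
  by rewrite -mulrA -exprnN mulVf ?mulr1// expf_neq0.
pose kappa := (1 - lambda * 2 ^+ d / 2) / 2 / (1 + lambda).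
(* The 4 comes from the diameter bound 4 n, and [expR kappa] from rounding the time down. *)
exists (4 * expR kappa), kappa; split; first by rewrite mulr_gt0 ?expR_gt0.
split.
  by rewrite !divr_gt0//; [rewrite subr_gt0 ltr_pdivrMr// mul1r|rewrite ltr_wpDr].
move=> L tau cL mL L0 mtau _ s s0 d1 d2 T1 T2 P1 P2 X Y dX dY /=.
have Lfin := compact_row_lebesgue_fin cL mL.
apply: (mixing_bound r_unit lambda_ge0 lambda_lt2 mL Lfin mtau _ s0 dX dY).
by rewrite fine_gt0// L0.
Qed.
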